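(* Let $f,L,g$ be continuous and assume that there are constants such that for all $x,y,z\in\mathbb{R}^d$, $u\in U$, $s\in[0,T]$ and all $t\in[0,T]$, $\tau>0$ with $t-\tau,t+\tau\in[0,T]$: (i) $|f(x,u,s)|\le M_f$, $|L(x,u,s)|\le M_L$, $|g(x)|\le M_g$; (ii) $|f(x,u,s)-f(y,u,s)|\le L_f|x-y|$ and $|L(x,u,s)-L(y,u,s)|\le L_L|x-y|$; (iii) $|g(x)-g(y)|\le L_g|x-y|$; (iv) $L(x+z,u,t+\tau)-2L(x,u,t)+L(x-z,u,t-\tau)\le C_L(|z|^2+\tau^2)$ and $g(x+z)-2g(x)+g(x-z)\le C_g|z|^2$; (v) $f(x,u,t)$ is Lipschitz continuous in space and time, uniformly in $u$; (vi) $|f(x+z,u,t+\tau)-2f(x,u,t)+f(x-z,u,t-\tau)|\le C_f(|z|^2+\tau^2)$. Assume that the pruning tolerance satisfies $\varepsilon_{\mathcal T}\le C\Delta t^2$ for a constant $C$ independent of $\Delta t$. Let $v$ be the value function and $V^P$ the pruned discrete value function. Then there are constants $C^*(T)$ and $\widehat C(T)$, not depending on $\Delta t$, such that for all $(x,t)\in\mathbb{R}^d\times[0,T]$ $$|v(x,t)-V^P(x,t)|\le\big(C^*(T)+\widehat C(T)\big)\Delta t.$$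
   Context: Fix $T>0$, $\lambda\ge 0$, integers $d,m\ge1$ and a finite set of controls $U=\{u_1,\dots,u_M\}\subset\mathbb{R}^m$. The data are $f:\mathbb{R}^d\times\mathbb{R}^m\times[0,T]\to\mathbb{R}^d$, $L:\mathbb{R}^d\times\mathbb{R}^m\times[0,T]\to\mathbb{R}$ (arguments: state, control, time) and $g:\mathbb{R}^d\to\mathbb{R}$. For $(x,t)\in\mathbb{R}^d\times[0,T]$ let $\mathcal{U}$ be the set of measurable $u:[t,T]\to U$; it is assumed that for each $u\in\mathcal{U}$ there is a unique solution $y(\cdot)$ of $\dot y(s)=f(y(s),u(s),s)$, $s\in(t,T]$, $y(t)=x$. The value function is $$v(x,t)=\inf_{u\in\mathcal{U}}\Big\{\int_t^T L(y(s),u(s),s)e^{-\lambda(s-t)}ds+g(y(T))e^{-\lambda(T-t)}\Big\}.$$ Time grid: $\Delta t=T/\overline N$, $t_n=n\Delta t$, $n=0,\dots,\overline N$. For an initial time $s\in[t_n,t_{n+1})$, $\mathcal{U}^\Delta$ is the set of controls $u=\sum_{k=n}^{\overline N-1}u^k\chi_{[t_k,t_{k+1})}$ with $u^k\in U$. Pruned discrete value function: for a tolerance $\varepsilon_{\mathcal T}>0$, a point $x$ and a finite family $\{x_i\}$ put $\mathcal{E}_{\varepsilon_{\mathcal T}}(x,\{x_i\})=x_k-x$ if $k\in\arg\min_i|x-x_i|$ and $|x-x_k|\le\varepsilon_{\mathcal T}$, and $\mathcal{E}_{\varepsilon_{\mathcal T}}(x,\{x_i\})=0$ otherwise. The pruned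 tree rooted at $(x,s)$ is built level by level: from each retained node $\eta^k$ of level $k$ and each control one computes the explicit Euler step, and replaces the result $\zeta$ by $\zeta+\mathcal{E}_{\varepsilon_{\mathcal T}}(\zeta,\{\eta^{k+1}_i\}_i)$, where $\{\eta^{k+1}_i\}_i$ are the nodes of level $k+1$ already computed and retained (so a new node within $\varepsilon_{\mathcal T}$ of a retained one is merged with it). The pruned trajectory for $u\in\mathcal{U}^\Delta$ is therefore $\eta^{n+1}=x+(t_{n+1}-s)f(x,u^n,s)+\mathcal{E}_{\varepsilon_{\mathcal T}}(x+(t_{n+1}-s)f(x,u^n,s),\{\eta^{n+1}_i\}_i)$ and $\eta^{k+1}=\eta^k+\Delta t f(\eta^k,u^k,t_k)+\mathcal{E}_{\varepsilon_{\mathcal T}}(\eta^k+\Delta t f(\eta^k,u^k,t_k),\{\eta^{k+1}_i\}_i)$ for $k\ge n+1$. Then $$J^{\Delta t,P}_{x,s}(u)=(t_{n+1}-s)L(x,u^n,s)+\Delta t\sum_{k=n+1}^{\overline N-1}L(\eta^k,u^k,t_k)e^{-\lambda(t_k-s)}+g(\eta^{\overline N})e^{-\lambda(T-s)},$$ $V^P(x,s)=\inf_{u\in\mathcal{U}^\Delta}J^{\Delta t,P}_{x,s}(u)$, and $V^P(x,T)=g(x)$. *)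

(* Defs.v *)
From HB Require Import structures.
From mathcomp Require Import all_boot all_order all_algebra.
From mathcomp Require Import all_classical all_reals all_analysis.
Import Order.TTheory GRing.Theory Num.Theory.
Import numFieldNormedType.Exports.

Set Implicit Arguments.
Unset Strict Implicit.
Unset Printing Implicit Defensive.

Local Open Scope classical_set_scope.
Local Open Scope ring_scope.

(* The library norm `|_| on row vectors is the max norm; the pruning rule
   depends on the norm, so the Euclidean one is needed. *)
Definition enorm (R : realType) (n : nat) (x : 'rV[R]_n) : R :=
  Num.sqrt (\sum_(i < n) x 0 i ^+ 2).

Section ContinuousProblem.
Context (R : realType) (d m : nat).
Variables (T lambda : R) (U : seq 'rV[R]_m).
Variables (f : 'rV[R]_d -> 'rV[R]_m -> R -> 'rV[R]_d)
          (L : 'rV[R]_d -> 'rV[R]_m -> R -> R) (g : 'rV[R]_d -> R).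

(* The codomain R^m carries its Borel sigma-algebra; only the restriction of u
   to [t, T] is relevant. *)
Definition control (t : R) (u : R -> 'rV[R]_m) : Prop :=
  measurable_fun (`[t, T] : set (measurableTypeR R))
    (u : measurableTypeR R -> g_sigma_algebraType (@open 'rV[R]_m)) /\
  (forall s, t <= s <= T -> u s \in U).

(* Since u is only measurable, the differential equation is understood in the
   sense of Caratheodory, i.e. as an integral equation; the integral of the
   vector-valued integrand is taken coordinatewise. *)
Definition solution (x : 'rV[R]_d) (t : R) (u : R -> 'rV[R]_m)
    (y : R -> 'rV[R]_d) : Prop :=
  {within `[t, T], continuous y} /\
  (forall s, t <= s <= T -> forall i : 'I_d,
     y s 0 i = x 0 i + \int[lebesgue_measure]_(r in `[t, s]) f (y r) (u r) r 0 i).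

Definition uniquely_solvable : Prop :=
  forall (x : 'rV[R]_d) (t : R), 0 <= t <= T -> forall u, control t u ->
  exists2 y, solution x t u y &
    forall y', solution x t u y' -> forall s, t <= s <= T -> y' s = y s.

Definition cost (t : R) (u : R -> 'rV[R]_m) (y : R -> 'rV[R]_d) : R :=
  \int[lebesgue_measure]_(s in `[t, T])
     (L (y s) (u s) s * expR (- lambda * (s - t)))
  + g (y T) * expR (- lambda * (T - t)).

Definition value (x : 'rV[R]_d) (t : R) : R :=
  inf [set c | exists u y, [/\ control t u, solution x t u y & c = cost t u y]].

End ContinuousProblem.

Section Pruning.
Context (R : realType) (d : nat) (W : eqType).
Local Notation V := 'rV[R]_d.

(* nearest x s is an element of argmin_{z in s} |x - z|; how ties are broken is
   left open. *)
Definition argmin_rule (nearest : V -> seq V -> V) : Prop :=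
  forall (x : V) (s : seq V), s != [::] ->
    nearest x s \in s /\
    (forall z, z \in s -> enorm (x - nearest x s) <= enorm (x - z)).

(* order k is the order in which the pairs (node of level k, control) are
   visited when level k.+1 is built. *)
Definition visit_order (order : nat -> seq (V * W) -> seq (V * W)) : Prop :=
  forall (k : nat) (s : seq (V * W)), perm_eq (order k s) s.

Variables (nearest : V -> seq V -> V) (eps : R).

Definition prune_err (x : V) (s : seq V) : V :=
  if (s != [::]) && (enorm (x - nearest x s) <= eps) then nearest x s - x
  else 0.

Definition pruned (z : V) (s : seq V) : V := z + prune_err z s.

Variable step : V -> W -> V.

Definition add_node (s : seq V) (p : V * W) : seq V :=
  let z := pruned (step p.1 p.2) s in if z \in s then s else rcons s z.

(* Nodes of the new level retained after the pairs in jobs have been visited,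
   in this order. *)
Definition retained (jobs : seq (V * W)) : seq V := foldl add_node [::] jobs.

Definition child (jobs : seq (V * W)) (p : V * W) : V :=
  pruned (step p.1 p.2) (retained (take (index p jobs) jobs)).

End Pruning.

Section DiscreteProblem.
Context (R : realType) (d m : nat).
Variables (T lambda : R) (U : seq 'rV[R]_m).
Variables (f : 'rV[R]_d -> 'rV[R]_m -> R -> 'rV[R]_d)
          (L : 'rV[R]_d -> 'rV[R]_m -> R -> R) (g : 'rV[R]_d -> R).
Variables (N : nat) (eps : R).
Variables (order : nat -> seq ('rV[R]_d * 'rV[R]_m) -> seq ('rV[R]_d * 'rV[R]_m))
          (nearest : 'rV[R]_d -> seq 'rV[R]_d -> 'rV[R]_d).

Definition Dt : R := T / N%:R.
Definition grid (n : nat) : R := n%:R * Dt.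

(* For 0 <= s, the n such that grid n <= s < grid n.+1 *)
Definition grid_index (s : R) : nat := Num.truncn (s / Dt).

(* The tree rooted at (x, s), s in [t_n, t_n.+1), is indexed by depth: depth 0
   is the root, at time s, and depth j > 0 is level n + j, at time t_(n + j). *)
Definition tree_time (s : R) (j : nat) : R :=
  if j is 0%N then s else grid (grid_index s + j).

Definition tree_dt (s : R) (j : nat) : R :=
  if j is 0%N then grid (grid_index s).+1 - s else Dt.

Definition euler (s : R) (j : nat) (eta : 'rV[R]_d) (u : 'rV[R]_m) : 'rV[R]_d :=
  eta + tree_dt s j *: f eta u (tree_time s j).

Definition jobs_of (j : nat) (nodes : seq 'rV[R]_d) :=
  order j [seq (eta, u) | eta <- nodes, u <- U].

Fixpoint tree_level (x : 'rV[R]_d) (s : R) (j : nat) : seq 'rV[R]_d :=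
  if j is i.+1 then retained nearest eps (euler s i) (jobs_of i (tree_level x s i))
  else [:: x].

(* The control sum_k u^k chi_[t_k, t_k.+1) is given by its coefficients u^k;
   eta^k is pruned_traj x s u (k - n). *)
Fixpoint pruned_traj (x : 'rV[R]_d) (s : R) (u : nat -> 'rV[R]_m) (j : nat)
    : 'rV[R]_d :=
  if j is i.+1 then
    child nearest eps (euler s i) (jobs_of i (tree_level x s i))
      (pruned_traj x s u i, u (grid_index s + i)%N)
  else x.

Definition discrete_control (s : R) (u : nat -> 'rV[R]_m) : Prop :=
  forall k, (grid_index s <= k < N)%N -> u k \in U.

Definition pruned_cost (x : 'rV[R]_d) (s : R) (u : nat -> 'rV[R]_m) : R :=
  let n := grid_index s in
  let eta k := pruned_traj x s u (k - n)%N in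
  (grid n.+1 - s) * L x (u n) s
  + Dt * (\sum_(n.+1 <= k < N)
            L (eta k) (u k) (grid k) * expR (- lambda * (grid k - s)))
  + g (eta N) * expR (- lambda * (T - s)).

Definition pruned_value (x : 'rV[R]_d) (s : R) : R :=
  if s == T then g x
  else inf [set pruned_cost x s u | u in [set u | discrete_control s u]].

End DiscreteProblem.

(* Main.v *)
Require Import Defs.
From HB Require Import structures.
From mathcomp Require Import all_boot all_order all_algebra.
From mathcomp Require Import all_classical all_reals all_analysis.
From mathcomp Require Import measurable_realfun ring lra zify.
Import Order.TTheory GRing.Theory Num.Theory.
Import numFieldNormedType.Exports.

(** Discounting both costs to time 0 removes the factor exp(-lambda (t - s)), and
    the first, partial time step changes either cost by O(Dt) only, so everything
    is compared at the grid times.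

    The lower bound for the value function rests on the semiconcavity of the
    unpruned discrete value V_k.  On one time step a measurable control moves the
    state, up to O(Dt^2), by the average of the Euler steps of the controls of U,
    weighted by the time spent on each of them; as the Euler steps are O(Dt) apart,
    Jensen's inequality for V_{k+1}, semiconcave uniformly in k and Dt, shows that
    V_k exceeds the cost of this relaxed step by at most O(Dt^2).  Conversely a
    piecewise constant control is itself admissible.  In both directions, and for
    the pruning error, errors of size O(Dt^2) in the state at each step add up to
    O(Dt) by the Lipschitz continuity of the discrete cost.

    L need not be Lipschitz in time, but it is semiconcave and bounded: along a
    Lipschitz path its oscillations over the grid steps have a bounded sum, so
    that the quadrature error is O(Dt) as well. *)

Set Implicit Arguments.
Unset Strict Implicit.

Local Open Scope classical_set_scope.
Local Open Scope ring_scope.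

(** A measurable control may switch arbitrarily often inside one grid cell, so no single element of
    [U] follows its trajectory: an Euler step with one fixed control misses it by order h. A
    Lipschitz bound would charge this at each of the T / h steps, a total of order 1. Only a
    second-order estimate of the averaged step survives the summation, which is why the discrete
    value must be semiconcave with a constant that does not grow with the number of steps. That
    constant is found for the cost of a fixed control and passes to the infimum.

    The assumptions on second differences displace the time by a strictly positive tau on both
    sides. Letting tau tend to 0 turns them into estimates in space at a fixed time, but only
    strictly between 0 and T. Hence the backward induction uses the indices 0 < k < N, and every
    comparison starts at the first grid time after the initial time; at k = N only [g] is left.

    The integral equation is read coordinatewise; this is the origin of the factors d in the
    constants. *)

Section EuclideanNorm.
Context (R : realType) (d : nat).
Implicit Types (x y : 'rV[R]_d) (a e : R).

Lemma enorm_ge0 x : 0 <= enorm x.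
Proof. exact: sqrtr_ge0. Qed.

Lemma sqr_enorm x : enorm x ^+ 2 = \sum_(i < d) x 0 i ^+ 2.
Proof. by rewrite sqr_sqrtr// sumr_ge0// => i _; rewrite sqr_ge0. Qed.

Lemma enorm0 : enorm (0 : 'rV[R]_d) = 0.
Proof.
by rewrite /enorm big1 ?sqrtr0// => i _; rewrite mxE expr0n.
Qed.

Lemma enormZ a x : enorm (a *: x) = `|a| * enorm x.
Proof.
rewrite /enorm -sqrtr_sqr -sqrtrM ?sqr_ge0//; congr Num.sqrt.
by rewrite mulr_sumr; apply: eq_bigr => i _; rewrite mxE exprMn.
Qed.

Lemma enormN x : enorm (- x) = enorm x.
Proof. by rewrite -scaleN1r enormZ normrN1 mul1r. Qed.

Lemma enormC x y : enorm (x - y) = enorm (y - x).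
Proof. by rewrite -enormN opprB. Qed.

Lemma coord_le_enorm x i : `|x 0 i| <= enorm x.
Proof.
rewrite -(ler_pXn2r (_ : 0 < 2)%N) ?nnegrE ?enorm_ge0//.
rewrite sqr_enorm real_normK ?num_real// (bigD1 i)//= lerDl sumr_ge0// => j _.
exact: sqr_ge0.
Qed.

(** Passes from coordinatewise integral bounds to the Euclidean norm. The factor is d rather than
    its square root, using d <= d^2. *)
Lemma enorm_le_coord x e : (forall i, `|x 0 i| <= e) -> 0 <= e ->
  enorm x <= d%:R * e.
Proof.
move=> xe e0; rewrite -(ler_pXn2r (_ : 0 < 2)%N) ?nnegrE ?enorm_ge0 ?mulr_ge0//.
rewrite sqr_enorm (@le_trans _ _ (\sum_(i < d) e ^+ 2))//.
  apply: ler_sum => i _; rewrite -real_normK ?num_real//.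
  by rewrite ler_pXn2r ?nnegrE.
rewrite sumr_const card_ord -[leLHS]mulr_natl exprMn ler_wpM2r ?sqr_ge0//.
case: d => [|k]; first by rewrite expr0n.
by rewrite expr2 ler_peMr// ler1n.
Qed.

(* Cauchy-Schwarz, from the sum of the squares |y| x_i - |x| y_i *)
Lemma dot_le_enorm x y : \sum_(i < d) x 0 i * y 0 i <= enorm x * enorm y.
Proof.
set D := \sum_(i < d) _; set a := enorm x; set b := enorm y.
have a0 : 0 <= a := enorm_ge0 x; have b0 : 0 <= b := enorm_ge0 y.
have : 0 <= \sum_(i < d) (b * x 0 i - a * y 0 i) ^+ 2.
  by apply: sumr_ge0 => i _; exact: sqr_ge0.
have -> : \sum_(i < d) (b * x 0 i - a * y 0 i) ^+ 2 =
    2 * (a * b) * (a * b - D).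
  rewrite (eq_bigr (fun i => b ^+ 2 * x 0 i ^+ 2 + a ^+ 2 * y 0 i ^+ 2
      + - (2 * (a * b)) * (x 0 i * y 0 i))); last by move=> i _; ring.
  by rewrite !big_split /= -!mulr_sumr -!sqr_enorm -/a -/b -/D; ring.
have [ab0|] := ltP 0 (a * b).
  by rewrite pmulr_rge0 ?subr_ge0// mulr_gt0.
move=> ab0 _; rewrite (@le_trans _ _ 0) ?mulr_ge0//.
have : a * b == 0 by rewrite eq_le ab0 mulr_ge0.
have coord0 (z : 'rV[R]_d) : enorm z = 0 -> forall i, z 0 i = 0.
  by move=> z0 i; apply/eqP; rewrite -normr_le0 -z0 coord_le_enorm.
by rewrite mulf_eq0 => /orP[] /eqP /coord0 z0; rewrite /D big1// => i _;
  rewrite z0 ?mul0r ?mulr0.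
Qed.

Lemma ler_enormD x y : enorm (x + y) <= enorm x + enorm y.
Proof.
rewrite -(ler_pXn2r (_ : 0 < 2)%N) ?nnegrE ?addr_ge0 ?enorm_ge0//.
rewrite sqrrD !sqr_enorm.
rewrite (eq_bigr (fun i => x 0 i ^+ 2 + 2 * (x 0 i * y 0 i) + y 0 i ^+ 2)).
  rewrite !big_split /= -mulr_sumr -!sqr_enorm.
  by have := dot_le_enorm x y; lra.
by move=> i _; rewrite mxE; ring.
Qed.

(** The exact convexity defect of the squared norm; it makes subtracting c / 2 times the squared
    norm turn semiconcavity into concavity. *)
Lemma sqr_enorm_convex (t : R) x y :
  enorm ((1 - t) *: x + t *: y) ^+ 2 =
  (1 - t) * enorm x ^+ 2 + t * enorm y ^+ 2 - t * (1 - t) * enorm (y - x) ^+ 2.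
Proof.
rewrite !sqr_enorm !mulr_sumr -big_split -sumrB /=.
by apply: eq_bigr => i _; rewrite !mxE; ring.
Qed.

End EuclideanNorm.

(** * Bounded semiconcave functions and Jensen's inequality with a quadratic error *)

Section Semiconcave.
Context (R : realType).

(** Boundedness from below replaces continuity, without which midpoint concavity would not suffice.
    Any lower bound -b can be improved to -b / 2; applied to the infimum itself, this rules out a
    negative infimum. *)
Lemma midpoint_concave_ge0 (p : R -> R) (B : R) :
  (forall t, 0 <= t <= 1 -> - B <= p t) -> 0 <= p 0 -> 0 <= p 1 ->
  (forall t s, 0 < s -> 0 <= t - s -> t + s <= 1 ->
     p (t - s) + p (t + s) <= 2 * p t) ->
  forall t, 0 <= t <= 1 -> 0 <= p t.
Proof.
move=> pB p0 p1 pm.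
(* Reflecting an endpoint of [0, 1] through t halves any lower bound. *)
have halve b : 0 <= b -> (forall t, 0 <= t <= 1 -> - b <= p t) ->
    forall t, 0 <= t <= 1 -> - (b / 2) <= p t.
  move=> b0 pb t /andP[t0 t1].
  have [->|tn0] := eqVneq t 0; first lra.
  have [->|tn1] := eqVneq t 1; first lra.
  have {}t0 : 0 < t by rewrite lt_neqAle eq_sym tn0.
  have {}t1 : t < 1 by rewrite lt_neqAle tn1.
  have [th|th] := leP t (1 / 2).
    have := pm t t t0; rewrite subrr lexx => /(_ isT) h.
    have := pb (t + t) ltac:(apply/andP; split; lra).
    by have := h ltac:(lra); lra.
  have := pm t (1 - t) ltac:(lra) ltac:(lra) ltac:(lra).
  have := pb (t - (1 - t)) ltac:(apply/andP; split; lra).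
  by rewrite (_ : t + (1 - t) = 1); [lra|ring].
set S := [set p t | t in [set t | 0 <= t <= 1]].
have S0 : S !=set0 by exists (p 0), 0 => //=; rewrite lexx ler01.
have Slb : has_lbound S by exists (- B) => _ [t /= t01 <-]; exact: pB.
have inf_le t : 0 <= t <= 1 -> inf S <= p t.
  by move=> t01; apply: ge_inf => //; exists t.
move=> t t01; have [i0|i0] := leP 0 (inf S); first exact: le_trans i0 (inf_le _ t01).
have := halve (- inf S) ltac:(lra) ltac:(by move=> s /inf_le; rewrite opprK).
move=> h; suff : inf S / 2 <= inf S by lra.
by apply: lb_le_inf => // _ [s /= s01 <-]; have := h _ s01; lra.
Qed.

(** The parabola k t (1 - t) has second difference exactly -2 k s^2, so adding it to the gap between
    [h] and its chord gives a midpoint concave function that vanishes at both ends. *)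
Lemma semiconcave_segment (h : R -> R) (B k : R) :
  (forall t, 0 <= t <= 1 -> `|h t| <= B) ->
  (forall t s, 0 < s -> 0 <= t - s -> t + s <= 1 ->
     h (t - s) + h (t + s) - 2 * h t <= 2 * k * s ^+ 2) ->
  forall t, 0 <= t <= 1 ->
    (1 - t) * h 0 + t * h 1 - k * (t * (1 - t)) <= h t.
Proof.
move=> hB hm t t01; rewrite -subr_ge0.
pose p (t : R) := h t - ((1 - t) * h 0 + t * h 1 - k * (t * (1 - t))).
rewrite -[leRHS]/(p t); apply: (@midpoint_concave_ge0 p (3 * B + `|k|)) => //.
- move=> s s01; have := hB _ s01.
  have := hB 0 ltac:(by rewrite lexx ler01).
  have := hB 1 ltac:(by rewrite lexx ler01).
  case/andP: s01 => s0 s1; rewrite !ler_norml /p => /andP[a1 a2] /andP[b1 b2].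
  move=> /andP[c1 c2].
  have e1 : (1 - s) * h 0 <= B.
    by rewrite (@le_trans _ _ ((1 - s) * B)) ?ler_wpM2l//; nra.
  have e2 : s * h 1 <= B.
    by rewrite (@le_trans _ _ (s * B)) ?ler_wpM2l//; nra.
  have e3 : - `|k| <= k * (s * (1 - s)).
    have : `|k * (s * (1 - s))| <= `|k|.
      have s2 : 0 <= s * (1 - s) by rewrite mulr_ge0 ?subr_ge0.
      by rewrite normrM (ger0_norm s2) ler_piMr//; nra.
    by rewrite ler_norml => /andP[].
  by lra.
- by rewrite /p; lra.
- by rewrite /p; lra.
- move=> s r r0 sr0 sr1; have := hm s r r0 sr0 sr1; rewrite /p; nra.
Qed.

Context (d : nat).
Implicit Types (W G : 'rV[R]_d -> R).

Lemma semiconcave_convex_comb W (B c : R) :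
  (forall x, `|W x| <= B) ->
  (forall x z : 'rV[R]_d, W (x + z) + W (x - z) - 2 * W x <= c * enorm z ^+ 2) ->
  forall x y t, 0 <= t <= 1 ->
    (1 - t) * W x + t * W y - c / 2 * (t * (1 - t)) * enorm (y - x) ^+ 2
      <= W ((1 - t) *: x + t *: y).
Proof.
move=> WB Wc x y t t01.
pose h (t : R) := W ((1 - t) *: x + t *: y).
have := @semiconcave_segment h B (c / 2 * enorm (y - x) ^+ 2) _ _ t t01.
rewrite /h !subr0 !subrr !scale0r !scale1r addr0 add0r => H.
rewrite -[_ * enorm _ ^+ 2]mulrAC; apply: H => [s _|s r r0 _ _]; first exact: WB.
have := Wc ((1 - s) *: x + s *: y) (r *: (y - x)).
rewrite enormZ exprMn real_normK ?num_real//.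
have -> : (1 - s) *: x + s *: y + r *: (y - x) =
   (1 - (s + r)) *: x + (s + r) *: y by apply/rowP => i; rewrite !mxE; ring.
have -> : (1 - s) *: x + s *: y - r *: (y - x) =
   (1 - (s - r)) *: x + (s - r) *: y by apply/rowP => i; rewrite !mxE; ring.
by move: (W _) (W _) (W _) => a b e; lra.
Qed.

(** The weights are kept unnormalised because they will be durations. The induction merges the tail
    into its barycentre [m], which exists only if the tail has positive weight; otherwise all its
    terms vanish. *)
Lemma jensen_finite (A : eqType) G (s : seq A) (w : A -> R) (q : A -> 'rV[R]_d) :
  (forall x y t, 0 <= t <= 1 ->
     (1 - t) * G x + t * G y <= G ((1 - t) *: x + t *: y)) ->
  (forall v, v \in s -> 0 <= w v) -> 0 < \sum_(v <- s) w v ->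
  \sum_(v <- s) w v * G (q v) <=
  (\sum_(v <- s) w v) * G ((\sum_(v <- s) w v)^-1 *: \sum_(v <- s) w v *: q v).
Proof.
move=> Gc; elim: s => [|a s ih] w0; first by rewrite big_nil ltxx.
have ws v : v \in s -> 0 <= w v by move=> vs; rewrite w0// inE vs orbT.
have wa : 0 <= w a by rewrite w0// inE eqxx.
rewrite !big_cons; set o := \sum_(v <- s) w v => wo.
have o0 : 0 <= o by rewrite /o big_seq sumr_ge0.
have [oz|on0] := eqVneq o 0.
  have wz v : v \in s -> w v = 0.
    move=> vs; move/eqP: oz; rewrite /o big_seq psumr_eq0// => /allP/(_ v vs).
    by rewrite vs => /eqP.
  have -> : \sum_(v <- s) w v * G (q v) = 0.
    by rewrite big_seq big1// => v /wz ->; rewrite mul0r.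
  have -> : \sum_(v <- s) w v *: q v = 0.
    by rewrite big_seq big1// => v /wz ->; rewrite scale0r.
  move: wo; rewrite oz !addr0 => wa0.
  by rewrite scalerA mulVf ?scale1r// gt_eqF.
have {}o0 : 0 < o by rewrite lt_neqAle eq_sym on0.
have {}ih := ih ws o0.
set m := o^-1 *: _ in ih.
have on : w a + o != 0 by rewrite gt_eqF.
have t01 : 0 <= o / (w a + o) <= 1.
  by rewrite divr_ge0 ?(ltW wo) ?(ltW o0)//= ler_pdivrMr// mul1r lerDr.
have := Gc (q a) m _ t01.
have -> : (1 - o / (w a + o)) *: q a + (o / (w a + o)) *: m =
    (w a + o)^-1 *: (w a *: q a + \sum_(v <- s) w v *: q v).
  rewrite /m !scalerA scalerDr scalerA; congr (_ *: _ + _ *: _); field=> //.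
  by rewrite on.
rewrite -(ler_pM2l wo); apply: le_trans.
have -> : (w a + o) * ((1 - o / (w a + o)) * G (q a) + o / (w a + o) * G m) =
  w a * G (q a) + o * G m by field.
by rewrite lerD2l.
Qed.

(** Jensen's inequality for the concave function W (x + p) - c / 2 |p|^2. The quadratic term at the
    barycentre has the favourable sign and is dropped, so the price is the second moment of the
    displacements [q], of order h^2 per unit of weight for Euler steps. *)
Lemma semiconcave_jensen W (B c : R) (A : eqType) (s : seq A) (w : A -> R)
    (q : A -> 'rV[R]_d) (x : 'rV[R]_d) (o : R) :
  (forall x, `|W x| <= B) ->
  (forall x z : 'rV[R]_d, W (x + z) + W (x - z) - 2 * W x <= c * enorm z ^+ 2) ->
  0 <= c -> (forall v, v \in s -> 0 <= w v) -> \sum_(v <- s) w v = o -> 0 < o ->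
  \sum_(v <- s) w v * W (x + q v) <=
  o * W (x + o^-1 *: \sum_(v <- s) w v *: q v)
  + c / 2 * \sum_(v <- s) w v * enorm (q v) ^+ 2.
Proof.
move=> WB Wc c0 w0 wo o0.
pose G (p : 'rV[R]_d) : R := W (x + p) - c / 2 * enorm p ^+ 2.
have Gc (p y : 'rV[R]_d) (t : R) : 0 <= t <= 1 ->
     (1 - t) * G p + t * G y <= G ((1 - t) *: p + t *: y).
  move=> t01; rewrite /G sqr_enorm_convex.
  have := semiconcave_convex_comb WB Wc (x + p) (x + y) t01.
  have -> : (1 - t) *: (x + p) + t *: (x + y) = x + ((1 - t) *: p + t *: y).
    by apply/rowP => i; rewrite !mxE; ring.
  have -> : x + y - (x + p) = y - p by apply/rowP => i; rewrite !mxE; ring.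
  by lra.
have := @jensen_finite _ G s w q Gc w0; rewrite wo => /(_ o0); rewrite /G.
under eq_bigr do rewrite mulrBr.
rewrite sumrB lerBlDr => /le_trans; apply; rewrite mulrBr.
rewrite mulr_sumr; under [X in _ + X <= _]eq_bigr do rewrite mulrCA.
rewrite -addrA lerD2l gerDr oppr_le0.
by rewrite mulr_ge0 ?(ltW o0)// mulr_ge0 ?divr_ge0// sqr_ge0.
Qed.

End Semiconcave.

Lemma step_index (N j k : nat) : (0 < k)%N -> (k + j.+1 <= N)%N ->
  (0 < k < N)%N /\ (k.+1 + j <= N)%N.
Proof. by lia. Qed.

(** * Discrete Gronwall estimate *)

Section Growth.
Context (R : realType).

(** Closed form for the recursion that sends K to b + q * K, with the slack b <= b * q ^ j.+1. It
    drives both the Lipschitz and the semiconcavity induction. *)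
Lemma affine_growth_step (q a b : R) (j : nat) : 1 <= q -> 0 <= b ->
  b + q * ((a + j%:R * b) * q ^+ j) <= (a + j.+1%:R * b) * q ^+ j.+1.
Proof.
move=> q1 b0; rewrite -natr1 exprS.
have : b <= b * (q * q ^+ j) by rewrite ler_peMr// -exprS exprn_ege1.
by move: (q ^+ j) => Q; lra.
Qed.

Lemma affine_growth_le (a b c h T : R) (j : nat) : 0 <= a -> 0 <= b -> 0 <= c ->
  0 <= h -> j%:R * h <= T ->
  (a + j%:R * (h * b)) * (1 + h * c) ^+ j <= (a + T * b) * expR (c * T).
Proof.
move=> a0 b0 c0 h0 jT; rewrite ler_pM//.
- by rewrite addr_ge0// mulr_ge0// mulr_ge0.
- by rewrite exprn_ge0// addr_ge0// mulr_ge0.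
- by rewrite lerD2l mulrA ler_wpM2r.
rewrite (@le_trans _ _ (expR (j%:R * (h * c))))//.
  rewrite expRM_natl lerXn2r ?nnegrE ?expR_ge0 ?expR_ge1Dx//.
  by rewrite addr_ge0// mulr_ge0.
by rewrite ler_expR mulrA [leRHS]mulrC ler_wpM2r.
Qed.

End Growth.

(** * Backward estimates for the unpruned discrete cost and value at interior grid indices *)

Section DiscreteCost.
Context (R : realType) (d : nat) (A : eqType).
Local Notation V := 'rV[R]_d.
Variables (U : seq A) (N : nat) (h T : R).
Variables (F : nat -> V -> A -> V) (l : nat -> V -> A -> R) (g : V -> R).

(* j is the number of remaining steps and k the current time index. *)
Fixpoint dcost (j k : nat) (x : V) (u : nat -> A) : R :=
  if j is i.+1 then h * l k x (u k) + dcost i k.+1 (x + h *: F k x (u k)) u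
  else g x.

Definition admissible (j k : nat) (u : nat -> A) : Prop :=
  forall i, (k <= i < k + j)%N -> u i \in U.

Definition dvalue (j k : nat) (x : V) : R :=
  inf [set dcost j k x u | u in admissible j k].

Lemma admissibleS j k u : admissible j.+1 k u ->
  u k \in U /\ admissible j k.+1 u.
Proof.
move=> ad; split; first by apply: ad; rewrite leqnn addnS ltnS leq_addr.
by move=> i ki; apply: ad; lia.
Qed.

Lemma eq_dcost j k x u u' : (forall i, (k <= i)%N -> u i = u' i) ->
  dcost j k x u = dcost j k x u'.
Proof.
elim: j k x => [//|j ih] k x uu' /=; rewrite uu'//; congr (_ + _).
by apply: ih => i /ltnW; exact: uu'.
Qed.

Variables (Mf ML Mg Lf LL Lg CL Cg Cf : R).
Hypotheses (h0 : 0 < h) (hT : h <= T) (hNT : N%:R * h <= T) (U0 : (0 < size U)%N).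
Hypotheses (ML0 : 0 <= ML) (Lf0 : 0 <= Lf) (LL0 : 0 <= LL) (Lg0 : 0 <= Lg)
  (CL0 : 0 <= CL) (Cg0 : 0 <= Cg) (Cf0 : 0 <= Cf).
Hypothesis gM : forall x, `|g x| <= Mg.
Hypothesis gL : forall x y, `|g x - g y| <= Lg * enorm (x - y).
Hypothesis gC : forall x z, g (x + z) - 2 * g x + g (x - z) <= Cg * enorm z ^+ 2.
Hypothesis lM : forall k v x, (0 < k < N)%N -> v \in U -> `|l k x v| <= ML.
Hypothesis lL : forall k v x y, (0 < k < N)%N -> v \in U ->
  `|l k x v - l k y v| <= LL * enorm (x - y).
Hypothesis lC : forall k v x z, (0 < k < N)%N -> v \in U ->
  l k (x + z) v - 2 * l k x v + l k (x - z) v <= CL * enorm z ^+ 2.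
Hypothesis FM : forall k v x, (0 < k < N)%N -> v \in U -> enorm (F k x v) <= Mf.
Hypothesis FL : forall k v x y, (0 < k < N)%N -> v \in U ->
  enorm (F k x v - F k y v) <= Lf * enorm (x - y).
Hypothesis FC : forall k v x z, (0 < k < N)%N -> v \in U ->
  enorm (F k (x + z) v - 2 *: F k x v + F k (x - z) v) <= Cf * enorm z ^+ 2.

Let T0 : 0 <= T. Proof. exact: le_trans (ltW h0) hT. Qed.
Let h0' : 0 <= h. Proof. exact: ltW. Qed.

Definition dcost_max : R := Mg + T * ML.
Definition dcost_lip : R := (Lg + T * LL) * expR (Lf * T).
(** Per step, the second difference gains h * ([CL] + [dcost_lip] * [Cf]) and is multiplied by (1 +
    h Lf)^2, which is at most 1 + h (2 Lf + T Lf^2) since h <= T. The product with [Cf] appears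
    because the Euler map is not affine in the state. *)
Definition dcost_semi : R :=
  (Cg + T * (CL + dcost_lip * Cf)) * expR ((2 * Lf + T * Lf ^+ 2) * T).

Lemma dcost_lip_ge0 : 0 <= dcost_lip.
Proof. by rewrite mulr_ge0 ?expR_ge0// addr_ge0// mulr_ge0. Qed.

Lemma dcost_semi_ge0 : 0 <= dcost_semi.
Proof.
by rewrite mulr_ge0 ?expR_ge0// addr_ge0// mulr_ge0// addr_ge0// mulr_ge0//
  dcost_lip_ge0.
Qed.

Lemma steps_le_horizon j k : (k + j <= N)%N -> j%:R * h <= T.
Proof.
move=> kj; apply: le_trans hNT; rewrite ler_wpM2r// ler_nat.
by rewrite (leq_trans _ kj)// leq_addl.
Qed.

Lemma dcost_bounded j k x u : (0 < k)%N -> (k + j <= N)%N ->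
  admissible j k u -> `|dcost j k x u| <= dcost_max.
Proof.
move=> k0 kj ad; apply: (@le_trans _ _ (Mg + j%:R * h * ML)); last first.
  by rewrite lerD2l ler_wpM2r// (steps_le_horizon kj).
elim: j k x k0 kj ad => [|j ih] k x k0 kj ad /=.
  by rewrite !mul0r addr0.
have [uk ad'] := admissibleS ad.
have [kN kj'] := step_index k0 kj.
have := ih k.+1 (x + h *: F k x (u k)) (ltn0Sn k) kj' ad'.
have := lM x kN uk; rewrite -natr1.
move=> h1 h2; apply: (le_trans (ler_normD _ _)).
rewrite normrM (ger0_norm h0').
have : h * `|l k x (u k)| <= h * ML by rewrite ler_wpM2l.
by lra.
Qed.

Lemma euler_lip k v x y : (0 < k < N)%N -> v \in U ->
  enorm (x + h *: F k x v - (y + h *: F k y v)) <= (1 + h * Lf) * enorm (x - y).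
Proof.
move=> kN vU.
have -> : x + h *: F k x v - (y + h *: F k y v) =
  (x - y) + h *: (F k x v - F k y v) by apply/rowP => i; rewrite !mxE; ring.
rewrite (le_trans (ler_enormD _ _))// enormZ (ger0_norm h0') mulrDl mul1r.
by rewrite lerD2l -mulrA ler_wpM2l// FL.
Qed.

Lemma dcost_lipschitz j k x y u : (0 < k)%N -> (k + j <= N)%N ->
  admissible j k u ->
  `|dcost j k x u - dcost j k y u| <= dcost_lip * enorm (x - y).
Proof.
move=> k0 kj ad.
apply: (@le_trans _ _ ((Lg + j%:R * (h * LL)) * (1 + h * Lf) ^+ j * enorm (x - y))).
  elim: j k x y k0 kj ad => [|j ih] k x y k0 kj ad.
    by rewrite mul0r addr0 expr0 mulr1; exact: gL.
  have [uk ad'] := admissibleS ad.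
  have [kN kj'] := step_index k0 kj.
  have q1 : 1 <= 1 + h * Lf by rewrite lerDl mulr_ge0.
  have b0 : 0 <= h * LL by rewrite mulr_ge0.
  apply: le_trans (ler_wpM2r (enorm_ge0 _) (affine_growth_step Lg j q1 b0)).
  rewrite /= opprD addrACA -mulrBr mulrDl (le_trans (ler_normD _ _))//.
  rewrite lerD//.
    by rewrite normrM (ger0_norm h0') -mulrA ler_wpM2l// lL.
  apply: le_trans (ih k.+1 _ _ (ltn0Sn k) kj' ad') _ => //.
  rewrite (mulrC (1 + h * Lf)) -[leRHS]mulrA ler_wpM2l//; last exact: euler_lip.
  rewrite mulr_ge0 ?exprn_ge0 ?(le_trans _ q1)//.
  by rewrite addr_ge0// mulr_ge0.
rewrite ler_wpM2r ?enorm_ge0// affine_growth_le//.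
exact: steps_le_horizon kj.
Qed.

Lemma dcost_semiconcave j k x z u : (0 < k)%N -> (k + j <= N)%N ->
  admissible j k u ->
  dcost j k (x + z) u + dcost j k (x - z) u - 2 * dcost j k x u
    <= dcost_semi * enorm z ^+ 2.
Proof.
set b := CL + dcost_lip * Cf; set c := 2 * Lf + T * Lf ^+ 2.
have b0 : 0 <= b by rewrite addr_ge0// mulr_ge0// dcost_lip_ge0.
have c0 : 0 <= c by rewrite addr_ge0 ?mulr_ge0// sqr_ge0.
move=> k0 kj ad.
apply: (@le_trans _ _ ((Cg + j%:R * (h * b)) * (1 + h * c) ^+ j * enorm z ^+ 2)).
  elim: j k x z k0 kj ad => [|j ih] k x z k0 kj ad.
    by rewrite mul0r addr0 expr0 mulr1 /=; have := gC x z; lra.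
  have [uk ad'] := admissibleS ad.
  have [kN kj'] := step_index k0 kj.
  have q1 : 1 <= 1 + h * c by rewrite lerDl mulr_ge0.
  have hb0 : 0 <= h * b by rewrite mulr_ge0.
  apply: le_trans (ler_wpM2r (sqr_ge0 _) (affine_growth_step Cg j q1 hb0)).
  rewrite /=; set v := u k.
  set pp := x + z + _; set pm := x - z + _; set p := x + h *: _.
  (* [q] and [zz] are the centre and the half difference of the two outer Euler images. The image
     [p] of the centre x differs from [q] by h / 2 times the second difference of [F]; the Lipschitz
     bound pays for this gap. *)
  pose zz := 2^-1 *: (pp - pm).
  pose q := p + (2^-1 * h) *: (F k (x + z) v - 2 *: F k x v + F k (x - z) v).
  have ppE : pp = q + zz by apply/rowP => i; rewrite /q /zz /pp /pm /p !mxE; field.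
  have pmE : pm = q - zz by apply/rowP => i; rewrite /q /zz /pp /pm /p !mxE; field.
  have := ih k.+1 q zz (ltn0Sn k) kj' ad'; rewrite -ppE -pmE.
  set K := (Cg + _) * _ => ihq.
  have K0 : 0 <= K.
    by rewrite mulr_ge0 ?exprn_ge0 ?(le_trans _ q1)// addr_ge0// mulr_ge0.
  have := @dcost_lipschitz j k.+1 q p u (ltn0Sn k) kj' ad'.
  rewrite (_ : q - p = (2^-1 * h) *: (F k (x + z) v - 2 *: F k x v + F k (x - z) v));
    last by rewrite /q [p + _]addrC addrK.
  rewrite enormZ (@ger0_norm _ (2^-1 * h)) ?mulr_ge0// => lipq.
  have : dcost_lip * (2^-1 * h * enorm (F k (x + z) v - 2 *: F k x v + F k (x - z) v))
      <= dcost_lip * (2^-1 * h * (Cf * enorm z ^+ 2)).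
    by rewrite ler_wpM2l ?dcost_lip_ge0// ler_wpM2l ?mulr_ge0// FC.
  move: lipq; rewrite ler_norml => /andP[_ lipq] Fsecond.
  have zz_le : enorm zz ^+ 2 <= (1 + h * c) * enorm z ^+ 2.
    apply: (@le_trans _ _ (((1 + h * Lf) * enorm z) ^+ 2)).
      rewrite ler_pXn2r ?nnegrE ?enorm_ge0 ?mulr_ge0 ?enorm_ge0//; last first.
        by rewrite addr_ge0// mulr_ge0.
      rewrite /zz enormZ ger0_norm//.
      have := @euler_lip k v (x + z) (x - z) kN uk.
      rewrite (_ : x + z - (x - z) = 2 *: z); last first.
        by apply/rowP => i; rewrite !mxE; ring.
      rewrite enormZ normr_nat /pp /pm; lra.
    rewrite exprMn ler_wpM2r ?sqr_ge0//.
    have : h * (h * Lf ^+ 2) <= h * (T * Lf ^+ 2).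
      by rewrite ler_wpM2l// ler_wpM2r// sqr_ge0.
    by rewrite /c; lra.
  have := lC x z kN uk; rewrite -/v => lsecond.
  have : h * (l k (x + z) v - 2 * l k x v + l k (x - z) v) <= h * (CL * enorm z ^+ 2).
    by rewrite ler_wpM2l.
  have : K * enorm zz ^+ 2 <= K * ((1 + h * c) * enorm z ^+ 2).
    by rewrite ler_wpM2l.
  rewrite /b; move: ihq Fsecond lipq.
  move: (enorm z ^+ 2) (dcost j _ pp u) (dcost j _ pm u) (dcost j _ p u).
  move: (dcost j _ q u) (enorm zz ^+ 2) (enorm _) (K) (c).
  by move=> Jq Z2 e K' c' Z Jpp Jpm Jp e1 e2 e3 e4 e5; lra.
rewrite ler_wpM2r ?sqr_ge0// affine_growth_le//.
exact: steps_le_horizon kj.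
Qed.

(** At each step the discrete cost is restarted from the actual point [z i.+1] instead of the Euler
    point, at the price lip * rho. It serves twice: for the exact trajectory of a piecewise constant
    control and for the pruned trajectory. *)
Lemma dcost_shadow j k (z : nat -> V) u (rho : R) : (0 < k)%N -> (k + j <= N)%N ->
  admissible j k u ->
  (forall i, (k <= i < k + j)%N ->
     enorm (z i.+1 - (z i + h *: F i (z i) (u i))) <= rho) ->
  `|\sum_(k <= i < k + j) h * l i (z i) (u i) + g (z (k + j)%N)
    - dcost j k (z k) u| <= j%:R * (dcost_lip * rho).
Proof.
elim: j k => [|j ih] k k0 kj ad zE.
  by rewrite addn0 big_geq// add0r subrr normr0 mul0r.
have [uk ad'] := admissibleS ad; have [kN kj'] := step_index k0 kj.
rewrite big_ltn ?addnS ?ltnS ?leq_addr//= -addSn.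
have zk : enorm (z k.+1 - (z k + h *: F k (z k) (u k))) <= rho.
  by apply: zE; rewrite leqnn addnS ltnS leq_addr.
have zE' i : (k.+1 <= i < k.+1 + j)%N ->
    enorm (z i.+1 - (z i + h *: F i (z i) (u i))) <= rho.
  by move=> /andP[ki ij]; apply: zE; rewrite addnS -addSn ij ltnW.
have := ih k.+1 (ltn0Sn k) kj' ad' zE'.
have := dcost_lipschitz (z k.+1) (z k + h *: F k (z k) (u k)) (ltn0Sn k) kj' ad'.
have : dcost_lip * enorm (z k.+1 - (z k + h *: F k (z k) (u k))) <= dcost_lip * rho.
  by rewrite ler_wpM2l// dcost_lip_ge0.
rewrite -natr1 !ler_norml; move: (\sum_(_ <= _ < _) _) (g _) => S G.
by move: (dcost _ _ _ _) (dcost _ _ _ _) => D D' e1 /andP[e2 e3] /andP[e4 e5];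
  apply/andP; split; lra.
Qed.

Lemma admissible_ex j k : exists u, admissible j k u.
Proof.
have [v vU] : exists v, v \in U.
  by case: U U0 => // v s _; exists v; exact: mem_head.
by exists (fun=> v).
Qed.

Lemma dvalue_le j k x u : (0 < k)%N -> (k + j <= N)%N -> admissible j k u ->
  dvalue j k x <= dcost j k x u.
Proof.
move=> k0 kj ad; apply: ge_inf; last by exists u.
exists (- dcost_max) => _ [u' ad' <-].
by have := dcost_bounded x k0 kj ad'; rewrite ler_norml => /andP[].
Qed.

Lemma le_dvalue j k x b :
  (forall u, admissible j k u -> b <= dcost j k x u) -> b <= dvalue j k x.
Proof.
move=> bJ; apply: lb_le_inf; last by move=> _ [u /bJ ? <-].
by have [u ad] := admissible_ex j k; exists (dcost j k x u), u.
Qed.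

Lemma dvalue_bounded j k x : (0 < k)%N -> (k + j <= N)%N ->
  `|dvalue j k x| <= dcost_max.
Proof.
move=> k0 kj; rewrite ler_norml; apply/andP; split.
  apply: le_dvalue => u ad.
  by have := dcost_bounded x k0 kj ad; rewrite ler_norml => /andP[].
have [u ad] := admissible_ex j k; apply: le_trans (dvalue_le x k0 kj ad) _.
by have := dcost_bounded x k0 kj ad; rewrite ler_norml => /andP[].
Qed.

Lemma dvalue_lipschitz j k x y : (0 < k)%N -> (k + j <= N)%N ->
  dvalue j k x <= dvalue j k y + dcost_lip * enorm (x - y).
Proof.
move=> k0 kj; rewrite -lerBlDr; apply: le_dvalue => u ad; rewrite lerBlDr.
apply: le_trans (dvalue_le x k0 kj ad) _.
have := dcost_lipschitz x y k0 kj ad; rewrite ler_norml => /andP[_].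
by rewrite lerBlDl.
Qed.

Lemma dvalue_semiconcave j k x z : (0 < k)%N -> (k + j <= N)%N ->
  dvalue j k (x + z) + dvalue j k (x - z) - 2 * dvalue j k x
    <= dcost_semi * enorm z ^+ 2.
Proof.
move=> k0 kj.
suff : (dvalue j k (x + z) + dvalue j k (x - z) - dcost_semi * enorm z ^+ 2) / 2
   <= dvalue j k x by lra.
apply: le_dvalue => u ad; have := dcost_semiconcave x z k0 kj ad.
have := dvalue_le (x + z) k0 kj ad; have := dvalue_le (x - z) k0 kj ad.
by move: (dvalue _ _ _) (dvalue _ _ _) => a b; lra.
Qed.

(** One half of the dynamic programming principle: a control of the later steps is overwritten by
    [v] at index k, which the cost from [k.+1] on does not see. *)
Lemma dvalue_step j k x v : (0 < k)%N -> (k + j.+1 <= N)%N -> v \in U ->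
  dvalue j.+1 k x <= h * l k x v + dvalue j k.+1 (x + h *: F k x v).
Proof.
move=> k0 kj vU; rewrite -lerBlDl; apply: le_dvalue => u ad; rewrite lerBlDl.
pose u' i := if i == k then v else u i.
have ad' : admissible j.+1 k u'.
  move=> i /andP[ki ij]; rewrite /u'; case: eqVneq => // ik; apply: ad.
  by rewrite ltn_neqAle eq_sym ik ki addSn -addnS.
have := dvalue_le x k0 kj ad'; rewrite /= /u' eqxx.
rewrite (@eq_dcost j k.+1 _ _ u)// => i ki.
by rewrite gtn_eqF.
Qed.

(* The relaxed step spends the time w v on the control v; semiconcavity of the
   discrete value makes it worth at most O(h^2) more than the best pure one. *)
Lemma dvalue_relaxed_step j k x (w : A -> R) : (0 < k)%N -> (k + j.+1 <= N)%N ->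
  (forall v, v \in U -> 0 <= w v) -> \sum_(v <- U) w v = h ->
  dvalue j.+1 k x <= \sum_(v <- U) w v * l k x v
    + dvalue j k.+1 (x + \sum_(v <- U) w v *: F k x v)
    + dcost_semi / 2 * (h ^+ 2 * Mf ^+ 2).
Proof.
move=> k0 kj w0 wh; have [kN kj'] := step_index k0 kj.
rewrite -(ler_pM2l h0).
have e1 : h * dvalue j.+1 k x <=
    \sum_(v <- U) w v * (h * l k x v + dvalue j k.+1 (x + h *: F k x v)).
  rewrite -{1}wh mulr_suml big_seq [leRHS]big_seq; apply: ler_sum => v vU.
  by rewrite ler_wpM2l ?w0// dvalue_step.
apply: le_trans e1 _; under eq_bigr do rewrite mulrDr mulrCA.
rewrite big_split /= -mulr_sumr.
have := @semiconcave_jensen _ _ (dvalue j k.+1) dcost_max dcost_semi A U w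
  (fun v => h *: F k x v) x h (fun y => dvalue_bounded y (ltn0Sn k) kj')
  (fun y z => dvalue_semiconcave y z (ltn0Sn k) kj') dcost_semi_ge0 w0 wh h0.
have -> : h^-1 *: \sum_(v <- U) w v *: (h *: F k x v) =
    \sum_(v <- U) w v *: F k x v.
  rewrite scaler_sumr; apply: eq_bigr => v _; rewrite !scalerA; congr (_ *: _).
  by field; rewrite gt_eqF.
have : dcost_semi / 2 * (\sum_(v <- U) w v * enorm (h *: F k x v) ^+ 2) <=
    dcost_semi / 2 * (h * (h ^+ 2 * Mf ^+ 2)).
  rewrite ler_wpM2l ?divr_ge0 ?dcost_semi_ge0// -{2}wh mulr_suml.
  rewrite big_seq [leRHS]big_seq; apply: ler_sum => v vU.
  rewrite ler_wpM2l ?w0// enormZ exprMn real_normK ?num_real//.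
  by rewrite ler_wpM2l ?sqr_ge0// lerXn2r ?nnegrE ?enorm_ge0 ?FM//
    (le_trans (enorm_ge0 _) (FM x kN vU)).
by move=> e1 e2; lra.
Qed.

(** Counterpart of [dcost_shadow] for relaxed steps: besides the displacement [rho], each step pays
    the Jensen error of order h^2. Only an upper bound for the value is available, since a relaxed
    step may beat the pure ones. *)
Lemma dvalue_relaxed_path j k (z : nat -> V) (w : nat -> A -> R) (rho : R) :
  (0 < k)%N -> (k + j <= N)%N ->
  (forall i v, (k <= i < k + j)%N -> v \in U -> 0 <= w i v) ->
  (forall i, (k <= i < k + j)%N -> \sum_(v <- U) w i v = h) ->
  (forall i, (k <= i < k + j)%N ->
     enorm (z i.+1 - (z i + \sum_(v <- U) w i v *: F i (z i) v)) <= rho) ->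
  dvalue j k (z k) <=
    \sum_(k <= i < k + j) \sum_(v <- U) w i v * l i (z i) v + g (z (k + j)%N)
    + j%:R * (dcost_lip * rho + dcost_semi / 2 * (h ^+ 2 * Mf ^+ 2)).
Proof.
elim: j k => [|j ih] k k0 kj w0 wh zE.
  rewrite addn0 big_geq// add0r mul0r addr0.
  have [u ad] := admissible_ex 0 k.
  by apply: (le_trans (dvalue_le (z k) k0 kj ad)).
have [kN kj'] := step_index k0 kj.
have kk : (k <= k < k + j.+1)%N by rewrite leqnn addnS ltnS leq_addr.
have kS i : (k.+1 <= i < k.+1 + j)%N -> (k <= i < k + j.+1)%N.
  by move=> /andP[ki ij]; rewrite addnS -addSn ij ltnW.
rewrite big_ltn ?addnS ?ltnS ?leq_addr// -addSn -natr1.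
have := ih k.+1 (ltn0Sn k) kj' (fun i v ki => w0 i v (kS i ki))
  (fun i ki => wh i (kS i ki)) (fun i ki => zE i (kS i ki)).
have := dvalue_relaxed_step (z k) k0 kj (fun v => w0 k v kk) (wh k kk).
set y := z k + _.
have := @dvalue_lipschitz j k.+1 y (z k.+1) (ltn0Sn k) kj'.
have : dcost_lip * enorm (y - z k.+1) <= dcost_lip * rho.
  by rewrite ler_wpM2l ?dcost_lip_ge0// enormC zE.
by move=> e1 e2 e3 e4; lra.
Qed.

End DiscreteCost.

(** * Oscillation in time of bounded semiconcave functions *)

Section TimeOscillation.
Context (R : realType) (d : nat).
Local Notation V := 'rV[R]_d.

(** P + K t is nondecreasing in time, so its oscillation on a cell is its increment there. Replacing
    [z i] by [z i.+1] at the right end of the cell costs at most Lam * B * h, after which the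
    increments telescope along the path. *)
Lemma one_sided_oscillation (P : V -> R -> R) (T M Lam K B h : R) (z : nat -> V)
    (k j : nat) :
  0 <= h -> 0 <= K -> 0 <= Lam -> 0 <= B -> (k + j)%:R * h <= T ->
  (forall x t, 0 <= t <= T -> `|P x t| <= M) ->
  (forall x y t, 0 <= t <= T -> `|P x t - P y t| <= Lam * enorm (x - y)) ->
  (forall x t t', 0 <= t -> t <= t' -> t' <= T -> P x t - K * (t' - t) <= P x t') ->
  (forall i, (k <= i < k + j)%N -> enorm (z i - z i.+1) <= B * h) ->
  exists a : nat -> R,
    (forall i r, (k <= i < k + j)%N -> i%:R * h <= r <= i.+1%:R * h ->
       `|P (z i) r - P (z i) (i%:R * h)| <= a i) /\
    \sum_(k <= i < k + j) a i <= 2 * M + T * (Lam * B + 2 * K).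
Proof.
move=> h0 K0 Lam0 B0 kjT PM PL PK zB.
have t0 i : 0 <= i%:R * h by rewrite mulr_ge0.
have tT i : (i <= k + j)%N -> i%:R * h <= T.
  by move=> ij; apply: le_trans kjT; rewrite ler_wpM2r// ler_nat.
have tS i : i.+1%:R * h = i%:R * h + h by rewrite -natr1 mulrDl mul1r.
(* Within the cell the deviation lies between -K h and the increment plus K h, and the increment is
   itself at least -K h; the term 2 K h covers both signs. *)
exists (fun i => P (z i) (i.+1%:R * h) - P (z i) (i%:R * h) + 2 * K * h); split.
  move=> i r /andP[ki ij] /andP[ir ri].
  have := PK (z i) _ _ (t0 i) ir (le_trans ri (tT _ ij)).
  have := PK (z i) _ _ (le_trans (t0 i) ir) ri (tT _ ij).
  rewrite tS in ri *.
  have : K * (r - i%:R * h) <= K * h by rewrite ler_wpM2l// lerBlDl.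
  have : K * (i%:R * h + h - r) <= K * h by rewrite ler_wpM2l//; lra.
  have := mulr_ge0 K0 h0.
  by move=> e0 e1 e2 e3 e4; rewrite ler_norml; apply/andP; split; lra.
apply: (@le_trans _ _ (\sum_(k <= i < k + j)
   ((P (z i.+1) (i.+1%:R * h) - P (z i) (i%:R * h)) + (Lam * B + 2 * K) * h))).
  apply: ler_sum_nat => i /andP[ki ij].
  have := PL (z i) (z i.+1) (i.+1%:R * h); rewrite t0 tT// => /(_ isT).
  have : Lam * enorm (z i - z i.+1) <= Lam * (B * h).
    by rewrite ler_wpM2l// zB// ki.
  by rewrite ler_norml => e /andP[_]; lra.
rewrite big_split /= (telescope_sumr (fun i => P (z i) (i%:R * h))) ?leq_addr//.
rewrite sumr_const_nat addKn -[X in _ + X]mulr_natl lerD//.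
  have := PM (z (k + j)%N) _ (introT andP (conj (t0 (k + j)%N) kjT)).
  have := PM (z k) (k%:R * h); rewrite t0 tT ?leq_addr// => /(_ isT).
  by rewrite !ler_norml /= => /andP[? ?] /andP[? ?]; lra.
rewrite mulrCA mulrC ler_wpM2r//; first by rewrite addr_ge0// mulr_ge0.
by apply: le_trans kjT; rewrite ler_wpM2r// ler_nat leq_addl.
Qed.

(** Variation plus curvature on the chord up to the far endpoint, divided by T / 2, the least length
    of such a chord. *)
Definition slope_bound (T M C : R) : R := (2 * M + C / 2 * T ^+ 2) * (2 / T).

Lemma slope_bound_ge0 (T M C : R) : 0 <= T -> 0 <= M -> 0 <= C ->
  0 <= slope_bound T M C.
Proof.
move=> T0 M0 C0; rewrite mulr_ge0 ?divr_ge0// addr_ge0 ?mulr_ge0 ?sqr_ge0//.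
Qed.

(** [p] lies above its chord from t to T, up to a quadratic defect, and T - t >= T / 2 keeps the
    slope of this chord bounded. Only descent is controlled: near 0 a semiconcave function may rise
    with unbounded slope, as the square root does. *)
Lemma semiconcave_slope_left (p : R -> R) (T M C : R) : 0 < T -> 0 <= C ->
  (forall t, 0 <= t <= T -> `|p t| <= M) ->
  (forall t s, 0 <= t <= T -> 0 < s -> 0 <= t - s <= T -> 0 <= t + s <= T ->
     p (t + s) - 2 * p t + p (t - s) <= C * s ^+ 2) ->
  forall t t', 0 <= t -> t <= t' -> t' <= T / 2 ->
    p t - slope_bound T M C * (t' - t) <= p t'.
Proof.
move=> T0 C0 pM pC t t' t0 tt' t'T.
have Tt : 0 < T - t by lra.
have T2 : 0 < T / 2 by lra.
set th := (t' - t) / (T - t).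
have th01 : 0 <= th <= 1.
  apply/andP; split; first by rewrite divr_ge0//; lra.
  by rewrite ler_pdivrMr//; lra.
have inT s : 0 <= s <= 1 -> 0 <= t + s * (T - t) <= T.
  by move=> /andP[s0 s1]; apply/andP; split; nra.
have := @semiconcave_segment _ (fun s => p (t + s * (T - t))) M
   (C / 2 * (T - t) ^+ 2) _ _ th th01.
rewrite mul0r addr0 mul1r [t + (T - t)]addrC subrK /th divfK ?gt_eqF//.
rewrite [t + (t' - t)]addrC subrK -/th => H.
have {}H : (1 - th) * p t + th * p T - C / 2 * (T - t) ^+ 2 * (th * (1 - th)) <= p t'.
  apply: H => [s /inT|s r r0 sr0 sr1]; first exact: pM.
  have e0 := inT s ltac:(apply/andP; split; lra).
  have e1 := inT (s - r) ltac:(apply/andP; split; lra).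
  have e2 := inT (s + r) ltac:(apply/andP; split; lra).
  have r0' : 0 < r * (T - t) by rewrite mulr_gt0.
  have E1 : t + s * (T - t) - r * (T - t) = t + (s - r) * (T - t) by ring.
  have E2 : t + s * (T - t) + r * (T - t) = t + (s + r) * (T - t) by ring.
  have := pC _ _ e0 r0'; rewrite E1 E2 => /(_ e1 e2).
  by move: (p _) (p _) (p _) => a b c; lra.
have := pM t ltac:(apply/andP; split; lra).
have := pM T ltac:(apply/andP; split; lra).
rewrite !ler_norml => /andP[a1 a2] /andP[b1 b2].
have thK : th * (2 * M + C / 2 * T ^+ 2) <= slope_bound T M C * (t' - t).
  rewrite /slope_bound -[leRHS]mulrA mulrC ler_wpM2l//.
    have := mulr_ge0 C0 (sqr_ge0 T).
    by lra.
  rewrite /th mulrC ler_wpM2r ?subr_ge0// -[2 / T]invf_div lef_pV2 ?posrE//.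
  by lra.
case/andP: th01 => h0 h1.
have : th * (- (2 * M)) <= th * (p T - p t) by rewrite ler_wpM2l//; lra.
have : C / 2 * (T - t) ^+ 2 * (th * (1 - th)) <= C / 2 * T ^+ 2 * th.
  apply: ler_pM.
  - by rewrite mulr_ge0 ?sqr_ge0// divr_ge0.
  - by rewrite mulr_ge0 ?subr_ge0.
  - by rewrite ler_wpM2l ?divr_ge0// lerXn2r ?nnegrE; lra.
  - by rewrite ler_piMr//; lra.
by lra.
Qed.

Lemma semiconcave_slope_right (p : R -> R) (T M C : R) : 0 < T -> 0 <= C ->
  (forall t, 0 <= t <= T -> `|p t| <= M) ->
  (forall t s, 0 <= t <= T -> 0 < s -> 0 <= t - s <= T -> 0 <= t + s <= T ->
     p (t + s) - 2 * p t + p (t - s) <= C * s ^+ 2) ->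
  forall t t', T / 2 <= t -> t <= t' -> t' <= T ->
    p t' <= p t + slope_bound T M C * (t' - t).
Proof.
move=> T0 C0 pM pC t t' Tt tt' t'T.
have := @semiconcave_slope_left (fun s => p (T - s)) T M C T0 C0 _ _ (T - t') (T - t).
rewrite (_ : T - (T - t') = t'); last by ring.
rewrite (_ : T - (T - t) = t); last by ring.
move=> H; have {}H : p t' - slope_bound T M C * (T - t - (T - t')) <= p t.
  apply: H => [s s01|s r /andP[s0 s1] r0 /andP[s2 s3] /andP[s4 s5]|||].
  - by apply: pM; case/andP: s01 => ? ?; apply/andP; split; lra.
  - have := pC (T - s) r ltac:(apply/andP; split; lra) r0
      ltac:(apply/andP; split; lra) ltac:(apply/andP; split; lra).
    rewrite (_ : T - (s + r) = T - s - r); last by ring.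
    rewrite (_ : T - (s - r) = T - s + r); last by ring.
    by move: (p _) (p _) (p _) => a b c; lra.
  - lra.
  - lra.
  - lra.
by lra.
Qed.

Definition oscillation_bound (T M Lam C B : R) : R :=
  2 * (2 * M + T * (Lam * B + 2 * slope_bound T M C)).

Lemma oscillation_bound_ge0 (T M Lam C B : R) :
  0 <= T -> 0 <= M -> 0 <= Lam -> 0 <= C -> 0 <= B ->
  0 <= oscillation_bound T M Lam C B.
Proof.
move=> T0 M0 Lam0 C0 B0; have K0 := slope_bound_ge0 T0 M0 C0.
apply: mulr_ge0 => //; apply: addr_ge0; first exact: mulr_ge0.
by apply: mulr_ge0 => //; apply: addr_ge0; exact: mulr_ge0.
Qed.

(* L is split at T/2 as L(., min(t, T/2)) + L(., max(t, T/2)) - L(., T/2): by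
   semiconcavity the difference quotients in time of the two pieces are bounded
   on one side, so that their oscillations telescope. *)
Lemma time_oscillation (L : V -> R -> R) (T M Lam C B h : R) (z : nat -> V)
    (k j : nat) :
  0 < T -> 0 <= h -> 0 <= C -> 0 <= Lam -> 0 <= B -> 0 <= M ->
  (k + j)%:R * h <= T ->
  (forall x t, 0 <= t <= T -> `|L x t| <= M) ->
  (forall x y t, 0 <= t <= T -> `|L x t - L y t| <= Lam * enorm (x - y)) ->
  (forall x t s, 0 <= t <= T -> 0 < s -> 0 <= t - s <= T -> 0 <= t + s <= T ->
     L x (t + s) - 2 * L x t + L x (t - s) <= C * s ^+ 2) ->
  (forall i, (k <= i < k + j)%N -> enorm (z i - z i.+1) <= B * h) ->
  exists a : nat -> R,
    (forall i r, (k <= i < k + j)%N -> i%:R * h <= r <= i.+1%:R * h ->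
       `|L (z i) r - L (z i) (i%:R * h)| <= a i) /\
    \sum_(k <= i < k + j) a i <= oscillation_bound T M Lam C B.
Proof.
move=> T0 h0 C0 Lam0 B0 M0 kjT LM LL LC zB.
set K := slope_bound T M C.
have K0 : 0 <= K by rewrite slope_bound_ge0// ltW.
have minT t : 0 <= t <= T -> 0 <= Num.min t (T / 2) <= T.
  move=> /andP[t0 tT]; rewrite le_min t0 ge_min tT/= divr_ge0 ?ltW//.
have maxT t : 0 <= t <= T -> 0 <= Num.max t (T / 2) <= T.
  by move=> /andP[t0 tT]; rewrite le_max t0 ge_max tT/=; lra.
pose P x t := L x (Num.min t (T / 2)).
(* The minus sign turns the bound on the rise of L over [T / 2, T] into the bound on descent that is
   required of [P]. *)
pose Q x t := - L x (Num.max t (T / 2)).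
have [||||a [aP aS]] := @one_sided_oscillation P T M Lam K B h z k j h0 K0 Lam0 B0 kjT.
- by move=> x t /minT; exact: LM.
- by move=> x y t /minT; exact: LL.
- move=> x t t' t0 tt' t'T; rewrite /P.
  have h1 : Num.min t (T / 2) <= Num.min t' (T / 2).
    by rewrite le_min !ge_min tt' lexx orbT.
  have h2 : Num.min t' (T / 2) <= T / 2 by rewrite ge_min lexx orbT.
  have h3 : 0 <= Num.min t (T / 2) by rewrite le_min t0 divr_ge0 ?ltW.
  apply: le_trans (semiconcave_slope_left T0 C0 (LM x) (LC x) h3 h1 h2).
  rewrite lerD2l lerN2 ler_wpM2l//.
  by rewrite !minEle; case: ifP; case: ifP; lra.
- by move=> i /zB.
have [||||b [bQ bS]] := @one_sided_oscillation Q T M Lam K B h z k j h0 K0 Lam0 B0 kjT.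
- by move=> x t /maxT; rewrite /Q normrN; exact: LM.
- by move=> x y t /maxT; rewrite /Q -opprD normrN; exact: LL.
- move=> x t t' t0 tt' t'T; rewrite /Q.
  have h1 : Num.max t (T / 2) <= Num.max t' (T / 2).
    by rewrite ge_max !le_max tt' lexx orbT.
  have h2 : T / 2 <= Num.max t (T / 2) by rewrite le_max lexx orbT.
  have h3 : Num.max t' (T / 2) <= T by rewrite ge_max t'T/=; lra.
  have := semiconcave_slope_right T0 C0 (LM x) (LC x) h2 h1 h3.
  have : K * (Num.max t' (T / 2) - Num.max t (T / 2)) <= K * (t' - t).
    rewrite ler_wpM2l//.
    by rewrite !maxEle; case: ifP; case: ifP; lra.
  by rewrite -/K; lra.
- by move=> i /zB.
have LPQ x t : L x t = P x t - Q x t - L x (T / 2).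
  rewrite /P /Q minEle maxEle; case: ifP => _; lra.
exists (fun i => a i + b i); split.
  move=> i r ki ir; have := aP i r ki ir; have := bQ i r ki ir.
  rewrite (LPQ _ r) (LPQ _ (i%:R * h)) !ler_norml => /andP[? ?] /andP[? ?]; apply/andP; split; lra.
rewrite big_split /=; apply: le_trans (lerD aS bS) _.
rewrite /oscillation_bound -/K.
by rewrite [leRHS]mulr_natl mulr2n.
Qed.

End TimeOscillation.

(** * Integrals along finitely valued measurable controls *)

Section OccupationTime.
Context (R : realType).
Local Notation mu := (@lebesgue_measure R).

Lemma bounded_integrable_itv (a b M : R) (f : R -> R) :
  measurable_fun `[a, b] f -> (forall r, a <= r <= b -> `|f r| <= M) ->
  mu.-integrable `[a, b] (EFin \o f).
Proof.
move=> mf fM; apply: measurable_bounded_integrable => //.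
  by rewrite /= lebesgue_measure_itv/= lte_fin; case: ifP => _; rewrite ltry.
exists M; split; first exact: num_real.
by move=> y My r; rewrite /= in_itv/= => /fM /le_trans -> //; exact: ltW.
Qed.

Lemma fine_lebesgue_itv (a b : R) : a <= b -> fine (mu `[a, b]) = b - a.
Proof.
move=> ab; rewrite lebesgue_measure_itv/= lte_fin; case: ltP => //= ba.
by apply/eqP; rewrite eq_sym subr_eq0 eq_le ab ba.
Qed.

Lemma Rintegral_itv_bound (a b M : R) (f : R -> R) : a <= b ->
  measurable_fun `[a, b] f -> (forall r, a <= r <= b -> `|f r| <= M) ->
  `|\int[mu]_(r in `[a, b]) f r| <= M * (b - a).
Proof.
move=> ab mf fM; have intf := bounded_integrable_itv mf fM.
apply: le_trans (le_normr_Rintegral _ intf) _ => //.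
rewrite -(fine_lebesgue_itv ab) -Rintegral_cst//; apply: le_Rintegral => //.
- apply: (@bounded_integrable_itv _ _ M) => [|r /fM]; last by rewrite normr_id.
  by apply: measurableT_comp.
- exact: (@bounded_integrable_itv _ _ `|M|).
Qed.

Lemma Rintegral_itv_split (a b c : R) (f : R -> R) : a <= b -> b <= c ->
  mu.-integrable `[a, c] (EFin \o f) ->
  \int[mu]_(r in `[a, c]) f r =
  \int[mu]_(r in `[a, b]) f r + \int[mu]_(r in `[b, c]) f r.
Proof.
move=> ab bc intf.
have := Rintegral_itvB intf; move=> /(_ b); rewrite !bnd_simp => /(_ ab bc).
rewrite Rintegral_itv_obnd_cbnd; last first.
  by apply: integrableS intf => //; apply: subset_itvr; rewrite bnd_simp.
by move=> <-; rewrite addrC subrK.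
Qed.

Context (A : eqType) (U : seq A) (u : R -> A) (a b : R).
Hypotheses (uU : uniq U) (ab : a <= b).
Hypothesis mu_u : forall v, measurable (`[a, b] `&` u @^-1` [set v] : set R).
Hypothesis inU : forall r, a <= r <= b -> u r \in U.

Definition occupation (v : A) : R := fine (mu (`[a, b] `&` u @^-1` [set v])).

Lemma occupation_ge0 v : 0 <= occupation v.
Proof. exact: fine_ge0. Qed.

Let S v : set R := `[a, b] `&` u @^-1` [set v].

(** Finiteness of [U] replaces composition with a measurable control by a finite sum over fixed
    controls, so that measurability is asked only of each [hh v]. Uniqueness in the list ensures
    that the active control is counted once. *)
Let select (hh : A -> R -> R) r : a <= r <= b ->
  hh (u r) r = \sum_(v <- U) \1_(S v) r * hh v r.
Proof.
move=> ab_r; rewrite (bigD1_seq (u r)) ?inU//= big1 ?addr0.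
  by rewrite indicE mem_set ?mul1r//; split => //=; rewrite in_itv.
move=> v /eqP vu; rewrite indicE memNset ?mul0r// => -[_ /= uv].
by apply: vu.
Qed.

Lemma measurable_select (hh : A -> R -> R) :
  (forall v, measurable_fun `[a, b] (hh v)) ->
  measurable_fun `[a, b] (fun r => hh (u r) r).
Proof.
move=> mh; apply: (eq_measurable_fun (fun r => \sum_(v <- U) \1_(S v) r * hh v r)).
  by move=> r; rewrite inE/= in_itv/= => /select ->.
apply: measurable_sum => v; apply: measurable_funM => //.
by apply: measurable_indic; exact: mu_u.
Qed.

Lemma Rintegral_select (c : A -> R) :
  \int[mu]_(r in `[a, b]) c (u r) = \sum_(v <- U) occupation v * c v.
Proof.
transitivity (\int[mu]_(r in `[a, b]) \sum_(v <- U) \1_(S v) r * c v).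
  by apply: eq_Rintegral => r; rewrite inE/= in_itv/= => /(select (fun v _ => c v)) ->.
have int1 v : mu.-integrable `[a, b] (EFin \o \1_(S v)).
  apply: (@bounded_integrable_itv _ _ 1); first by apply: measurable_indic; exact: mu_u.
  by move=> r _; rewrite indicE ger0_norm ?lern1 ?leq_b1.
have intM v : mu.-integrable `[a, b] (EFin \o (fun r => \1_(S v) r * c v)).
  apply: (@bounded_integrable_itv _ _ `|c v|).
    by apply: measurable_funM => //; by apply: measurable_indic; exact: mu_u.
  by move=> r _; rewrite normrM indicE ger0_norm// ler_piMl// lern1 leq_b1.
(* The list can be generalised here: that [u] takes its values in [U] was already used in rewriting
   through [select]. *)
elim: (U : seq A) => [|v s ih].
  under eq_Rintegral do rewrite big_nil.
  by rewrite big_nil Rintegral_cst// mul0r.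
under eq_Rintegral do rewrite big_cons.
rewrite big_cons RintegralD//; last first.
  apply: (@bounded_integrable_itv _ _ (\sum_(v <- s) `|c v|)).
    apply: measurable_sum => w; apply: measurable_funM => //.
    by apply: measurable_indic; exact: mu_u.
  move=> r _; apply: le_trans (ler_norm_sum _ _ _) _; apply: ler_sum => w _.
  by rewrite normrM indicE ger0_norm// ler_piMl// lern1 leq_b1.
rewrite ih RintegralZr//; congr (_ * _ + _).
rewrite /Rintegral integral_indic; [|by []|exact: mu_u].
by rewrite /occupation /S setIC setIA setIid.
Qed.

Lemma sum_occupation : \sum_(v <- U) occupation v = b - a.
Proof.
rewrite -(fine_lebesgue_itv ab) -[RHS]mul1r -Rintegral_cst//.
rewrite (Rintegral_select (fun=> 1)).
by apply: eq_bigr => v _; rewrite mulr1.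
Qed.

(** Freezing the integrand at c v for each control leaves a sum weighted by occupation times. Both
    the local error of the dynamics and that of the running cost are instances. *)
Lemma Rintegral_select_approx (hh : A -> R -> R) (c : A -> R) (e : R) :
  (forall v, measurable_fun `[a, b] (hh v)) ->
  (forall v r, v \in U -> a <= r <= b -> `|hh v r - c v| <= e) ->
  `|\int[mu]_(r in `[a, b]) hh (u r) r - \sum_(v <- U) occupation v * c v|
    <= e * (b - a).
Proof.
move=> mh hc; rewrite -Rintegral_select.
have mc : measurable_fun `[a, b] (fun r => c (u r)).
  by apply: (@measurable_select (fun v _ => c v)).
have mhu := measurable_select mh.
pose B := \sum_(v <- U) `|c v|.
have cB r : a <= r <= b -> `|c (u r)| <= B.
  move=> /inU uU'; rewrite /B (bigD1_seq (u r))//= lerDl.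
  exact: sumr_ge0.
rewrite -RintegralB//; last 2 first.
- apply: (@bounded_integrable_itv _ _ (e + B)) => // r ar.
  rewrite -[hh _ _](subrK (c (u r))) (le_trans (ler_normD _ _))// lerD ?cB//.
  by rewrite hc// inU.
- exact: (@bounded_integrable_itv _ _ B).
apply: Rintegral_itv_bound => //; first exact: measurable_funB.
by move=> r ar; rewrite hc// inU.
Qed.

End OccupationTime.

(** * Vanishing time displacements *)

Section Limits.
Context (R : realType).

Lemma expRN_dist (p q : R) : 0 <= p -> p <= q ->
  `|expR (- q) - expR (- p)| <= q - p.
Proof.
move=> p0 pq; rewrite distrC ger0_norm; last first.
  by rewrite subr_ge0 ler_expR lerN2.
have -> : - q = - p - (q - p) by ring.
rewrite expRD -{1}[expR (- p)]mulr1 -mulrBr.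
apply: (@le_trans _ _ (1 * (q - p))); last by rewrite mul1r.
apply: ler_pM; rewrite ?expR_ge0//.
- by rewrite subr_ge0 -expR0 ler_expR oppr_le0 subr_ge0.
- by rewrite -expR0 ler_expR oppr_le0.
- by have := expR_ge1Dx (- (q - p)); lra.
Qed.

Lemma le_small_linear (A B c del : R) : 0 < del -> 0 <= c ->
  (forall tau, 0 < tau -> tau < del -> A <= B + c * tau) -> A <= B.
Proof.
move=> del0 c0 AB; rewrite leNgt; apply/negP => BA.
have c1 : 0 < 2 * (c + 1) by lra.
pose t := Num.min (del / 2) ((A - B) / (2 * (c + 1))).
have t0 : 0 < t by rewrite lt_min !divr_gt0// subr_gt0.
have td : t < del by rewrite gt_min; apply/orP; left; lra.
have := AB t t0 td.
have : t <= (A - B) / (2 * (c + 1)) by rewrite ge_min lexx orbT.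
rewrite ler_pdivlMr// => h1 h2; nra.
Qed.

(** With p and q the data at x + z and x - z as functions of time, this removes the displacement tau
    from a joint second difference. *)
Lemma le_continuous_second_difference (p q : R -> R) (K C t del : R) :
  0 < del -> 0 <= C -> {for t, continuous p} -> {for t, continuous q} ->
  (forall tau, 0 < tau -> tau < del ->
     p (t + tau) + q (t - tau) <= K + C * tau ^+ 2) ->
  p t + q t <= K.
Proof.
move=> del0 C0 cp cq pq; apply/ler_addgt0Pr => e e0.
have e2 : 0 < e / 2 by lra.
have [d1 /= d10 H1] := (nbhs_ballP _ _).1 ((cvgrPdist_lt _ _).1 cp _ e2).
have [d2 /= d20 H2] := (nbhs_ballP _ _).1 ((cvgrPdist_lt _ _).1 cq _ e2).
pose d3 := Num.min del (Num.min 1 (Num.min d1 d2)).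
have d30 : 0 < d3 by rewrite !lt_min del0 ltr01 d10 d20.
apply: (@le_small_linear _ _ C d3) => // tau tau0.
rewrite !lt_min => /and4P[td t1 td1 td2].
have := pq tau tau0 td.
have : `|p t - p (t + tau)| < e / 2.
  by apply: H1; rewrite /ball/= opprD addrA subrr add0r normrN gtr0_norm.
have : `|q t - q (t - tau)| < e / 2.
  by apply: H2; rewrite /ball/= opprB addrCA subrr addr0 gtr0_norm.
have : C * tau ^+ 2 <= C * tau by rewrite ler_wpM2l// expr2 ler_piMl ?ltW.
by rewrite !ltr_norml => h /andP[? ?] /andP[? ?]; lra.
Qed.

End Limits.

(** * Continuity along paths and measurability of controls *)

Section Slab.
Context (R : realType) (d m : nat) (T : R).
Local Notation slab := [set p : 'rV[R]_d * 'rV[R]_m * R | 0 <= p.2 <= T].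

Lemma continuous_along_slab (E : topologicalType)
    (F : 'rV[R]_d -> 'rV[R]_m -> R -> E) (a b : R) (y : R -> 'rV[R]_d) v :
  0 <= a -> b <= T ->
  {within slab, continuous (fun p => F p.1.1 p.1.2 p.2)} ->
  {within `[a, b], continuous y} ->
  {within `[a, b], continuous (fun r => F (y r) v r)}.
Proof.
move=> a0 bT /subspace_continuousP Fc /subspace_continuousP yc.
apply/subspace_continuousP => r0 r0ab.
have inT r : `[a, b]%classic r -> 0 <= r <= T.
  rewrite /= in_itv/= => /andP[ar rb].
  by rewrite (le_trans a0 ar) (le_trans rb bT).
have := Fc (y r0, v, r0) (inT _ r0ab) => /= {}Fc.
apply: (@cvg_comp _ _ _ (fun r => (y r, v, r))
  (fun p : 'rV[R]_d * 'rV[R]_m * R => F p.1.1 p.1.2 p.2) _ _ _ _ Fc).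
have cv : (fun r => (y r, v, r)) @ within `[a, b] (nbhs r0) --> (y r0, v, r0).
    have c1 : (y r, v) @[r --> within `[a, b] (nbhs r0)] --> (y r0, v).
    exact: (cvg_pair (yc _ r0ab) (cvg_cst _)).
  exact: (cvg_pair c1 (@cvg_within _ _ _ `[a, b])).
(* The data are continuous only relative to the slab, so a neighbourhood [B] is known to be reached
   only by points of the slab; for r in [a, b] the path stays there. *)
move=> B HB.
have H1 : within `[a, b] (nbhs r0) [set r | slab (y r, v, r) -> B (y r, v, r)].
  exact: cv HB.
apply: (@filterS2 _ _ (within_filter _ _) _ _ _ _ H1 (withinT _ (nbhs_filter r0))).
by move=> r /= h /inT; exact: h.
Qed.

End Slab.

Section Controls.
Context (R : realType) (m : nat) (T : R) (U : seq 'rV[R]_m).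

Lemma measurable_set1_matrix (v : 'rV[R]_m) :
  measurable ([set v] : set (g_sigma_algebraType (@open 'rV[R]_m))).
Proof.
rewrite -[X in measurable X]setCK; apply: measurableC.
apply: sub_sigma_algebra; rewrite openC.
apply: accessible_closed_set1; apply: hausdorff_accessible.
exact: norm_hausdorff.
Qed.

Lemma control_preimage (t a b : R) u v : control T U t u -> t <= a -> b <= T ->
  measurable (`[a, b] `&` u @^-1` [set v] : set R).
Proof.
move=> [mu _] ta bT.
have := mu (measurable_itv _) _ (measurable_set1_matrix v).
have -> : `[a, b] `&` u @^-1` [set v] =
    `[a, b] `&` (`[t, T] `&` u @^-1` [set v]) :> set R.
  rewrite setIA; congr (_ `&` _); apply/seteqP; split=> r /=; last by case.
  rewrite !in_itv/= => /andP[ar rb]; split; first by rewrite ar.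
  by rewrite (le_trans ta ar) (le_trans rb bT).
by move=> H; apply: measurableI => //; exact: measurable_itv.
Qed.

End Controls.

(** * Exact trajectories over one time step *)

Section Comparison.
Context (R : realType) (d m : nat) (T lambda : R) (U : seq 'rV[R]_m).
Context (f : 'rV[R]_d -> 'rV[R]_m -> R -> 'rV[R]_d)
        (L : 'rV[R]_d -> 'rV[R]_m -> R -> R) (g : 'rV[R]_d -> R).
Context (Mf ML Mg Lf LL Lg CL Cg Kf Cf : R).
Local Notation mu := (@lebesgue_measure R).
Local Notation V := 'rV[R]_d.
Hypotheses (T0 : 0 < T) (lambda0 : 0 <= lambda) (uU : uniq U) (U0 : (0 < size U)%N).
Hypothesis f_cont : {within [set p : 'rV[R]_d * 'rV[R]_m * R | 0 <= p.2 <= T],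
  continuous (fun p => f p.1.1 p.1.2 p.2)}.
Hypothesis L_cont : {within [set p : 'rV[R]_d * 'rV[R]_m * R | 0 <= p.2 <= T],
  continuous (fun p => L p.1.1 p.1.2 p.2)}.
Hypotheses (Mf0 : 0 <= Mf) (ML0 : 0 <= ML) (Lf0 : 0 <= Lf)
  (LL0 : 0 <= LL) (Lg0 : 0 <= Lg) (CL0 : 0 <= CL) (Cg0 : 0 <= Cg) (Kf0 : 0 <= Kf)
  (Cf0 : 0 <= Cf).
Hypothesis fM : forall x u s, u \in U -> 0 <= s <= T -> enorm (f x u s) <= Mf.
Hypothesis LM : forall x u s, u \in U -> 0 <= s <= T -> `|L x u s| <= ML.
Hypothesis gM : forall x, `|g x| <= Mg.
Hypothesis fL : forall x y u s, u \in U -> 0 <= s <= T ->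
  enorm (f x u s - f y u s) <= Lf * enorm (x - y).
Hypothesis LLip : forall x y u s, u \in U -> 0 <= s <= T ->
  `|L x u s - L y u s| <= LL * enorm (x - y).
Hypothesis gLip : forall x y, `|g x - g y| <= Lg * enorm (x - y).
Hypothesis LC : forall x z u t tau, u \in U -> 0 <= t <= T -> 0 < tau ->
  0 <= t - tau <= T -> 0 <= t + tau <= T ->
  L (x + z) u (t + tau) - 2 * L x u t + L (x - z) u (t - tau)
    <= CL * (enorm z ^+ 2 + tau ^+ 2).
Hypothesis gC : forall x z, g (x + z) - 2 * g x + g (x - z) <= Cg * enorm z ^+ 2.
Hypothesis fK : forall x y u s t, u \in U -> 0 <= s <= T -> 0 <= t <= T ->
  enorm (f x u s - f y u t) <= Kf * (enorm (x - y) + `|s - t|).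
Hypothesis fC : forall x z u t tau, u \in U -> 0 <= t <= T -> 0 < tau ->
  0 <= t - tau <= T -> 0 <= t + tau <= T ->
  enorm (f (x + z) u (t + tau) - 2 *: f x u t + f (x - z) u (t - tau))
    <= Cf * (enorm z ^+ 2 + tau ^+ 2).

Lemma running_cost_semiconcave x z u t : u \in U -> 0 < t < T ->
  L (x + z) u t - 2 * L x u t + L (x - z) u t <= CL * enorm z ^+ 2.
Proof.
move=> uinU /andP[t0 tT].
have Lc y : {for t, continuous (fun r => L y u r)}.
  apply: (within_continuous_continuous T0); last by rewrite in_itv/= t0.
  apply: (@continuous_along_slab R d m T _ L 0 T (fun=> y) u) => //.
  by apply: continuous_subspaceT => r; exact: cvg_cst.
suff : L (x + z) u t + L (x - z) u t <= CL * enorm z ^+ 2 + 2 * L x u t by lra.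
apply: (@le_continuous_second_difference R (L (x + z) u) (L (x - z) u) _ CL t
  (Num.min t (T - t))) => //; first by rewrite lt_min t0 subr_gt0.
move=> tau tau0; rewrite lt_min => /andP[h1 h2].
have tT' : 0 <= t <= T by apply/andP; split; lra.
have e1 : 0 <= t - tau <= T by apply/andP; split; lra.
have e2 : 0 <= t + tau <= T by apply/andP; split; lra.
have := LC x z uinU tT' tau0 e1 e2.
by move: (L _ _ _) (L _ _ _) (L _ _ _) => a b c; lra.
Qed.

(** The limit tau -> 0 is made explicit by the Lipschitz dependence of [f] on time: moving the two
    outer times back to t costs 2 * Kf * tau. *)
Lemma dynamics_second_difference x z u t : u \in U -> 0 < t < T ->
  enorm (f (x + z) u t - 2 *: f x u t + f (x - z) u t) <= Cf * enorm z ^+ 2.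
Proof.
move=> uinU /andP[t0 tT].
apply: (@le_small_linear R _ _ (Cf + 2 * Kf)
  (Num.min 1 (Num.min t (T - t)))).
- by rewrite !lt_min ltr01 t0 subr_gt0.
- by rewrite addr_ge0// mulr_ge0.
move=> tau tau0; rewrite !lt_min => /and3P[h1 h2 h3].
have tT' : 0 <= t <= T by apply/andP; split; lra.
have e1 : 0 <= t - tau <= T by apply/andP; split; lra.
have e2 : 0 <= t + tau <= T by apply/andP; split; lra.
have := fC x z uinU tT' tau0 e1 e2.
have := fK (x + z) (x + z) uinU tT' e2.
have := fK (x - z) (x - z) uinU tT' e1.
rewrite !subrr enorm0 !add0r.
have -> : t - (t - tau) = tau by ring.
have -> : t - (t + tau) = - tau by ring.
rewrite normrN gtr0_norm//.
set a := f (x + z) u t; set b := f (x - z) u t; set c := 2 *: f x u t.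
set a' := f (x + z) u _; set b' := f (x - z) u _ => hb ha hc.
have -> : a - c + b = (a' - c + b') + ((a - a') + (b - b')).
  by apply/rowP => i; rewrite !mxE; ring.
apply: le_trans (ler_enormD _ _) _.
have := ler_enormD (a - a') (b - b').
have : Cf * tau ^+ 2 <= Cf * tau by rewrite ler_wpM2l// expr2 ler_piMl ?ltW.
by move: (enorm _) (enorm _) (enorm _) (enorm _) ha hb hc => e3 e4 e5 e6 ha hb hc; lra.
Qed.

Section Trajectory.
Context (x : V) (t : R) (u : R -> 'rV[R]_m) (y : R -> V).
Hypotheses (t0 : 0 <= t) (cu : control T U t u) (sy : solution T f x t u y).
Context (a b : R).
Hypotheses (ta : t <= a) (ab : a <= b) (bT : b <= T).

Let mu_u v : measurable (`[a, b] `&` u @^-1` [set v] : set R).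
Proof. exact: control_preimage cu ta bT. Qed.

Let inU r : a <= r <= b -> u r \in U.
Proof.
by move=> /andP[ar rb]; apply: cu.2; rewrite (le_trans ta ar) (le_trans rb bT).
Qed.

Let inT r : a <= r <= b -> 0 <= r <= T.
Proof.
move=> /andP[ar rb].
by rewrite (le_trans t0 (le_trans ta ar)) (le_trans rb bT).
Qed.

Lemma measurable_along (H : V -> 'rV[R]_m -> R -> R) v :
  {within [set p : 'rV[R]_d * 'rV[R]_m * R | 0 <= p.2 <= T],
    continuous (fun p => H p.1.1 p.1.2 p.2)} ->
  measurable_fun `[a, b] (fun r => H (y r) v r).
Proof.
move=> Hc; apply: subspace_continuous_measurable_fun; first exact: measurable_itv.
apply: continuous_along_slab Hc _ => //; first exact: le_trans t0 ta.
apply: continuous_subspaceW sy.1.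
by apply: subset_itv; rewrite bnd_simp.
Qed.

Lemma measurable_dynamics v i : measurable_fun `[a, b] (fun r => f (y r) v r 0 i).
Proof.
apply: (@measurable_along (fun x v r => f x v r 0 i)).
move=> p; apply: (@continuous_comp _ _ _ (fun p : subspace _ => f p.1.1 p.1.2 p.2)
  (fun M : 'rV[R]_d => M 0 i)); first exact: f_cont.
exact: coord_continuous.
Qed.

Lemma measurable_discount : measurable_fun `[a, b] (fun r => expR (- (lambda * r))).
Proof.
apply: measurableT_comp => //; apply: measurableT_comp => //.
Qed.

End Trajectory.

Lemma measurable_velocity x t u y a b i : 0 <= t -> control T U t u ->
  solution T f x t u y -> t <= a -> a <= b -> b <= T ->
  measurable_fun `[a, b] (fun r => f (y r) (u r) r 0 i).
Proof.
move=> t0 cu sy ta ab bT.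
apply: (@measurable_select R _ U u a b uU _ _ (fun v r => f (y r) v r 0 i)).
- by move=> v; exact: control_preimage cu ta bT.
- by move=> r /andP[ar rb]; apply: cu.2; rewrite (le_trans ta ar) (le_trans rb bT).
- by move=> v; exact: (measurable_dynamics t0 sy ta bT).
Qed.

Lemma solution_increment x t u y a b i : 0 <= t -> control T U t u ->
  solution T f x t u y -> t <= a -> a <= b -> b <= T ->
  y b 0 i - y a 0 i = \int[mu]_(r in `[a, b]) f (y r) (u r) r 0 i.
Proof.
move=> t0 cu sy ta ab bT.
have inta : t <= a <= T by rewrite ta (le_trans ab bT).
have intb : t <= b <= T by rewrite (le_trans ta ab) bT.
rewrite (sy.2 _ inta) (sy.2 _ intb) (@Rintegral_itv_split R t a b) //.
  by rewrite opprD addrACA subrr add0r [X in X - _]addrC addrK.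
apply: (@bounded_integrable_itv R t b Mf).
  exact: (measurable_velocity i t0 cu sy (lexx t) (le_trans ta ab) bT).
move=> r /andP[tr rb]; apply: le_trans (coord_le_enorm _ _) _; apply: fM.
  by apply: cu.2; rewrite tr (le_trans rb bT).
by rewrite (le_trans t0 tr) (le_trans rb bT).
Qed.

Lemma solution_lipschitz x t u y a b : 0 <= t -> control T U t u ->
  solution T f x t u y -> t <= a -> a <= b -> b <= T ->
  enorm (y b - y a) <= d%:R * (Mf * (b - a)).
Proof.
move=> t0 cu sy ta ab bT; apply: enorm_le_coord; last first.
  by rewrite mulr_ge0 ?subr_ge0.
move=> i; rewrite !mxE (solution_increment i t0 cu sy ta ab bT).
apply: Rintegral_itv_bound => //; first exact: (measurable_velocity i t0 cu sy ta).
move=> r /andP[ar rb]; apply: le_trans (coord_le_enorm _ _) _; apply: fM.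
  by apply: cu.2; rewrite (le_trans ta ar) (le_trans rb bT).
by rewrite (le_trans t0 (le_trans ta ar)) (le_trans rb bT).
Qed.

(** For each fixed control the velocity along y stays within Kf * (d * Mf + 1) * (b - a) of its
    value at time a, so freezing it leaves an error quadratic in b - a. However often [u] switches,
    only its occupation times matter. *)
Lemma solution_step x t u y a b : 0 <= t -> control T U t u ->
  solution T f x t u y -> t <= a -> a <= b -> b <= T ->
  enorm (y b - (y a + \sum_(v <- U) occupation u a b v *: f (y a) v a))
    <= d%:R * (Kf * ((d%:R * Mf + 1) * (b - a)) * (b - a)).
Proof.
move=> t0 cu sy ta ab bT; have ba0 : 0 <= b - a by rewrite subr_ge0.
have aT : 0 <= a <= T by rewrite (le_trans t0 ta) (le_trans ab bT).
apply: enorm_le_coord; last first.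
  by rewrite !mulr_ge0// addr_ge0// mulr_ge0.
move=> i; have -> : (y b - (y a + \sum_(v <- U) occupation u a b v *: f (y a) v a)) 0 i =
    (y b 0 i - y a 0 i) - \sum_(v <- U) occupation u a b v * f (y a) v a 0 i.
  rewrite !mxE opprD addrA summxE; congr (_ - _).
  by apply: eq_bigr => v _; rewrite mxE.
rewrite (solution_increment i t0 cu sy ta ab bT).
apply: (@Rintegral_select_approx R _ U u a b uU ab _ _
  (fun v r => f (y r) v r 0 i) (fun v => f (y a) v a 0 i)).
- by move=> v; exact: control_preimage cu ta bT.
- by move=> r /andP[ar rb]; apply: cu.2; rewrite (le_trans ta ar) (le_trans rb bT).
- by move=> v; exact: (measurable_dynamics t0 sy ta bT).
move=> v r vU /andP[ar rb].
have rT : 0 <= r <= T by rewrite (le_trans t0 (le_trans ta ar)) (le_trans rb bT).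
have -> : f (y r) v r 0 i - f (y a) v a 0 i = (f (y r) v r - f (y a) v a) 0 i.
  by rewrite !mxE.
apply: le_trans (coord_le_enorm _ _) _; apply: le_trans (fK _ _ vU rT aT) _.
rewrite ler_wpM2l// mulrDl mul1r lerD//.
  apply: le_trans (solution_lipschitz t0 cu sy ta ar (le_trans rb bT)) _.
  by rewrite -mulrA ler_wpM2l// ler_wpM2l// lerD2r.
by rewrite ger0_norm ?subr_ge0// lerD2r.
Qed.

(** The oscillation in time [e] stays a parameter: on a single step it need not be of order h, and
    only its sum over the steps will be bounded. *)
Lemma running_cost_step x t u y a b (e : R) : 0 <= t -> control T U t u ->
  solution T f x t u y -> t <= a -> a <= b -> b <= T ->
  (forall v r, v \in U -> a <= r <= b -> `|L (y a) v r - L (y a) v a| <= e) ->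
  `|\int[mu]_(r in `[a, b]) (L (y r) (u r) r * expR (- (lambda * r)))
    - \sum_(v <- U) occupation u a b v * (L (y a) v a * expR (- (lambda * a)))|
  <= (LL * (d%:R * (Mf * (b - a))) + e + ML * (lambda * (b - a))) * (b - a).
Proof.
move=> t0 cu sy ta ab bT Le.
have aT : 0 <= a <= T by rewrite (le_trans t0 ta) (le_trans ab bT).
apply: (@Rintegral_select_approx R _ U u a b uU ab _ _
  (fun v r => L (y r) v r * expR (- (lambda * r)))
  (fun v => L (y a) v a * expR (- (lambda * a)))).
- by move=> v; exact: control_preimage cu ta bT.
- by move=> r /andP[ar rb]; apply: cu.2; rewrite (le_trans ta ar) (le_trans rb bT).
- move=> v; apply: measurable_funM; last exact: measurable_discount.
  exact: (measurable_along t0 sy ta bT).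
move=> v r vU arb; have /andP[ar rb] := arb.
have rT : 0 <= r <= T by rewrite (le_trans t0 (le_trans ta ar)) (le_trans rb bT).
have -> : L (y r) v r * expR (- (lambda * r)) - L (y a) v a * expR (- (lambda * a)) =
   ((L (y r) v r - L (y a) v r) + (L (y a) v r - L (y a) v a)) * expR (- (lambda * r))
   + L (y a) v a * (expR (- (lambda * r)) - expR (- (lambda * a))) by ring.
apply: le_trans (ler_normD _ _) _; rewrite !normrM lerD//; last first.
  rewrite ler_pM ?normr_ge0 ?LM//.
  have := @expRN_dist R (lambda * a) (lambda * r).
  rewrite mulr_ge0 ?ler_wpM2l//; last by case/andP: aT.
  move=> /(_ isT isT) /le_trans; apply.
  by rewrite -mulrBr ler_wpM2l// lerD2r.
rewrite (ger0_norm (expR_ge0 _)) -[leRHS]mulr1 ler_pM ?normr_ge0 ?expR_ge0//.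
  apply: le_trans (ler_normD _ _) _; rewrite lerD ?Le//.
  apply: le_trans (LLip _ _ vU rT) _; rewrite ler_wpM2l//.
  apply: le_trans (solution_lipschitz t0 cu sy ta ar (le_trans rb bT)) _.
  by rewrite ler_wpM2l// ler_wpM2l// lerD2r.
by rewrite -expR0 ler_expR oppr_le0 mulr_ge0//; case/andP: rT.
Qed.

Lemma running_cost_integrable x t u y a b : 0 <= t -> control T U t u ->
  solution T f x t u y -> t <= a -> a <= b -> b <= T ->
  mu.-integrable `[a, b]
    (EFin \o (fun r => L (y r) (u r) r * expR (- (lambda * r)))) /\
  forall r, a <= r <= b -> `|L (y r) (u r) r * expR (- (lambda * r))| <= ML.
Proof.
move=> t0 cu sy ta ab bT.
have inU r : a <= r <= b -> u r \in U.
  by move=> /andP[ar rb]; apply: cu.2; rewrite (le_trans ta ar) (le_trans rb bT).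
have bnd r : a <= r <= b -> `|L (y r) (u r) r * expR (- (lambda * r))| <= ML.
  move=> arb; have /andP[ar rb] := arb.
  have rT : 0 <= r <= T by rewrite (le_trans t0 (le_trans ta ar)) (le_trans rb bT).
  rewrite normrM (ger0_norm (expR_ge0 _)) -[leRHS]mulr1.
  rewrite ler_pM ?normr_ge0 ?expR_ge0 ?LM ?inU//.
  by rewrite -expR0 ler_expR oppr_le0 mulr_ge0//; case/andP: rT.
split=> //; apply: bounded_integrable_itv bnd.
apply: (@measurable_select R _ U u a b uU _ _
  (fun v r => L (y r) v r * expR (- (lambda * r)))) => //.
- by move=> v; exact: control_preimage cu ta bT.
- move=> v; apply: measurable_funM; last exact: measurable_discount.
  exact: (measurable_along t0 sy ta bT).
Qed.

(** * Data sampled on the time grid and quadrature of the running cost *)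

Section Grid.
Context (N : nat) (N0 : (0 < N)%N).
Local Notation h := (Dt T N).

Lemma Dt_gt0 : 0 < h.
Proof. by rewrite divr_gt0// ltr0n. Qed.

Lemma mul_Dt : N%:R * h = T.
Proof. by rewrite /Dt mulrC divfK// pnatr_eq0 -lt0n. Qed.

Lemma Dt_le : h <= T.
Proof. by rewrite -{2}mul_Dt ler_peMl ?(ltW Dt_gt0)// ler1n. Qed.

Lemma grid_le (i j : nat) : (i <= j)%N -> i%:R * h <= j%:R * h.
Proof. by move=> ij; rewrite ler_wpM2r ?(ltW Dt_gt0)// ler_nat. Qed.

Lemma grid_le_horizon (i : nat) : (i <= N)%N -> i%:R * h <= T.
Proof. by move=> iN; rewrite -[leRHS]mul_Dt grid_le. Qed.

Lemma gridS (i : nat) : i.+1%:R * h - i%:R * h = h.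
Proof. by rewrite -mulrBl -natr1 addrC addKr mul1r. Qed.

Definition grid_dynamics (k : nat) (x : V) (v : 'rV[R]_m) : V := f x v (k%:R * h).
Definition grid_cost (k : nat) (x : V) (v : 'rV[R]_m) : R :=
  L x v (k%:R * h) * expR (- (lambda * (k%:R * h))).
Definition final_cost (x : V) : R := g x * expR (- (lambda * T)).

Lemma running_cost_grid x t u y k j (a : 'rV[R]_m -> nat -> R) :
  0 <= t -> control T U t u -> solution T f x t u y ->
  t <= k%:R * h -> (k + j <= N)%N ->
  (forall v i r, v \in U -> (k <= i < k + j)%N -> i%:R * h <= r <= i.+1%:R * h ->
     `|L (y (i%:R * h)) v r - L (y (i%:R * h)) v (i%:R * h)| <= a v i) ->
  `|\int[mu]_(r in `[k%:R * h, (k + j)%:R * h])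
      (L (y r) (u r) r * expR (- (lambda * r)))
    - \sum_(k <= i < k + j) \sum_(v <- U)
        occupation u (i%:R * h) (i.+1%:R * h) v * grid_cost i (y (i%:R * h)) v|
  <= \sum_(k <= i < k + j)
       ((LL * (d%:R * Mf) + ML * lambda) * h + \sum_(v <- U) a v i) * h.
Proof.
move=> t0 cu sy; elim: j k => [|j ih] k tk kj ha.
  by rewrite addn0 !big_geq// subr0 set_itv1 Rintegral_set1 normr0.
have kN : (k.+1 <= N)%N by apply: leq_trans kj; rewrite addnS ltnS leq_addr.
have kj' : (k.+1 + j <= N)%N by rewrite addSn -addnS.
have kkS : k%:R * h <= k.+1%:R * h by exact: grid_le.
have Skj : k.+1%:R * h <= (k.+1 + j)%:R * h by rewrite grid_le// leq_addr.
rewrite !(big_ltn (_ : (k < k + j.+1)%N)) ?addnS ?ltnS ?leq_addr// -!addSn.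
have [int _] := running_cost_integrable t0 cu sy tk (le_trans kkS Skj)
  (grid_le_horizon kj').
rewrite (Rintegral_itv_split kkS Skj int) opprD addrACA.
apply: le_trans (ler_normD _ _) _; apply: lerD; last first.
  apply: ih => //; first exact: le_trans tk kkS.
  by move=> v i r vU /andP[ki ij]; apply: ha => //; rewrite addnS -addSn ij ltnW.
have kk : (k <= k < k + j.+1)%N by rewrite leqnn addnS ltnS leq_addr.
have a0 v : v \in U -> 0 <= a v k.
  move=> vU; apply: le_trans (ha v k (k%:R * h) vU kk _); first exact: normr_ge0.
  by rewrite lexx.
have := @running_cost_step x t u y _ _ (\sum_(v <- U) a v k) t0 cu sy tk kkS
  (grid_le_horizon kN) _.
rewrite gridS => H; apply: (le_trans (H _)).
  move=> v r vU kr; apply: le_trans (ha v k r vU kk kr) _.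
  rewrite (bigD1_seq v)//= lerDl big_seq_cond sumr_ge0// => w /andP[wU _].
  exact: a0.
by rewrite ler_wpM2r ?(ltW Dt_gt0)//; lra.
Qed.

(** The first term collects the variation of state and discount. The oscillation bound is multiplied
    by the number of controls because it holds for each control separately, while [u] may use all of
    them within a step. *)
Definition quadrature_const : R :=
  T * (LL * (d%:R * Mf) + ML * lambda)
  + (size U)%:R * oscillation_bound T ML LL CL (d%:R * Mf).

Lemma running_cost_quadrature x t u y k j :
  0 <= t -> control T U t u -> solution T f x t u y ->
  t <= k%:R * h -> (k + j <= N)%N ->
  `|\int[mu]_(r in `[k%:R * h, (k + j)%:R * h])
      (L (y r) (u r) r * expR (- (lambda * r)))
    - \sum_(k <= i < k + j) \sum_(v <- U)
        occupation u (i%:R * h) (i.+1%:R * h) v * grid_cost i (y (i%:R * h)) v|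
  <= quadrature_const * h.
Proof.
move=> t0 cu sy tk kj.
have zB i : (k <= i < k + j)%N ->
    enorm (y (i%:R * h) - y (i.+1%:R * h)) <= d%:R * Mf * h.
  move=> /andP[ki ij]; rewrite enormC -[in leRHS](gridS i) -mulrA.
  apply: (solution_lipschitz t0 cu sy (le_trans tk (grid_le ki)) (grid_le (leqnSn i))).
  by rewrite grid_le_horizon// (leq_trans ij kj).
(* All controls are tested along the same sampled path y(t_i), but the bounding sequence depends on
   the control; outside [U] the zero sequence is a default about which nothing is claimed. *)
have /choice[a aP] : forall v : 'rV[R]_m, exists av : nat -> R, v \in U ->
    (forall i r, (k <= i < k + j)%N -> i%:R * h <= r <= i.+1%:R * h ->
       `|L (y (i%:R * h)) v r - L (y (i%:R * h)) v (i%:R * h)| <= av i) /\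
    \sum_(k <= i < k + j) av i <= oscillation_bound T ML LL CL (d%:R * Mf).
  move=> v; have [vU|vU] := boolP (v \in U); last by exists (fun=> 0).
  have B0 : 0 <= d%:R * Mf by rewrite mulr_ge0.
  have [|||||av avP] := @time_oscillation R d (fun x r => L x v r) T ML LL CL
    (d%:R * Mf) h (fun i => y (i%:R * h)) k j T0 (ltW Dt_gt0) CL0 LL0 B0 ML0 => //.
  - exact: grid_le_horizon.
  - by move=> z r rT; exact: LM.
  - by move=> z w r rT; exact: LLip.
  (* Joint semiconcavity with zero displacement in space is semiconcavity in time. *)
  - move=> z r s rT s0 s1 s2; have := LC z 0 vU rT s0 s1 s2.
    by rewrite addr0 subr0 enorm0 expr0n add0r.
  - by exists av.
apply: (le_trans (running_cost_grid t0 cu sy tk kj (a := a) _)).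
  by move=> v i r vU; exact: (aP v vU).1.
rewrite -mulr_suml ler_wpM2r ?(ltW Dt_gt0)// big_split /=; apply: lerD.
  rewrite sumr_const_nat addKn -[X in X <= _]mulr_natl.
  rewrite mulrCA mulrC ler_wpM2r//.
    by rewrite addr_ge0 ?mulr_ge0.
  by rewrite grid_le_horizon// (leq_trans _ kj)// leq_addl.
rewrite exchange_big /=.
apply: (@le_trans _ _ (\sum_(v <- U) oscillation_bound T ML LL CL (d%:R * Mf))).
  rewrite big_seq [leRHS]big_seq; apply: ler_sum => v vU.
  exact: (aP v vU).2.
by rewrite big_const_seq count_predT iter_addr_0 [leRHS]mulr_natl.
Qed.

Lemma grid_time_interior k : (0 < k < N)%N -> 0 < k%:R * h < T.
Proof.
move=> /andP[k0 kN]; rewrite mulr_gt0 ?ltr0n ?Dt_gt0//=.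
by rewrite -[ltRHS]mul_Dt ltr_pM2r ?Dt_gt0// ltr_nat.
Qed.

Lemma grid_time k : (0 < k < N)%N -> 0 <= k%:R * h <= T.
Proof. by move=> /grid_time_interior/andP[? ?]; rewrite !ltW. Qed.

Lemma discount_le1 t : 0 <= t -> 0 <= expR (- (lambda * t)) <= 1.
Proof. by move=> t0; rewrite expR_ge0 -expR0 ler_expR oppr_le0 mulr_ge0. Qed.

Lemma grid_cost_bounded k v x : (0 < k < N)%N -> v \in U ->
  `|grid_cost k x v| <= ML.
Proof.
move=> kN vU; have /andP[k0 kT] := grid_time kN; have /andP[e0 e1] := discount_le1 k0.
rewrite normrM (ger0_norm e0) -[leRHS]mulr1 ler_pM ?normr_ge0// LM//.
by rewrite k0.
Qed.

Lemma grid_cost_lipschitz k v x y : (0 < k < N)%N -> v \in U ->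
  `|grid_cost k x v - grid_cost k y v| <= LL * enorm (x - y).
Proof.
move=> kN vU; have /andP[k0 kT] := grid_time kN; have /andP[e0 e1] := discount_le1 k0.
rewrite -mulrBl normrM (ger0_norm e0) -[leRHS]mulr1 ler_pM ?normr_ge0// LLip//.
by rewrite k0.
Qed.

Lemma grid_cost_semiconcave k v (x z : V) : (0 < k < N)%N -> v \in U ->
  grid_cost k (x + z) v - 2 * grid_cost k x v + grid_cost k (x - z) v
    <= CL * enorm z ^+ 2.
Proof.
move=> kN vU; have /andP[k0 kT] := grid_time kN; have /andP[e0 e1] := discount_le1 k0.
have := running_cost_semiconcave x z vU (grid_time_interior kN).
rewrite /grid_cost; set S := _ - _ + _ => SC.
have -> : L (x + z) v (k%:R * h) * expR (- (lambda * (k%:R * h))) -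
    2 * (L x v (k%:R * h) * expR (- (lambda * (k%:R * h)))) +
    L (x - z) v (k%:R * h) * expR (- (lambda * (k%:R * h))) =
    S * expR (- (lambda * (k%:R * h))) by rewrite /S; ring.
have CZ : 0 <= CL * enorm z ^+ 2 by rewrite mulr_ge0 ?sqr_ge0.
apply: (@le_trans _ _ (CL * enorm z ^+ 2 * expR (- (lambda * (k%:R * h))))).
  by rewrite ler_wpM2r.
by rewrite ler_piMr.
Qed.

Lemma final_cost_bounded x : `|final_cost x| <= Mg.
Proof.
have /andP[e0 e1] := discount_le1 (ltW T0).
by rewrite normrM (ger0_norm e0) -[leRHS]mulr1 ler_pM ?normr_ge0.
Qed.

Lemma final_cost_lipschitz x y :
  `|final_cost x - final_cost y| <= Lg * enorm (x - y).
Proof.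
have /andP[e0 e1] := discount_le1 (ltW T0).
by rewrite -mulrBl normrM (ger0_norm e0) -[leRHS]mulr1 ler_pM ?normr_ge0.
Qed.

Lemma final_cost_semiconcave (x z : V) :
  final_cost (x + z) - 2 * final_cost x + final_cost (x - z) <= Cg * enorm z ^+ 2.
Proof.
have /andP[e0 e1] := discount_le1 (ltW T0).
have := gC x z; rewrite /final_cost; set S := _ - _ + _ => SC.
have -> : g (x + z) * expR (- (lambda * T)) - 2 * (g x * expR (- (lambda * T))) +
    g (x - z) * expR (- (lambda * T)) = S * expR (- (lambda * T)).
  by rewrite /S; ring.
have CZ : 0 <= Cg * enorm z ^+ 2 by rewrite mulr_ge0 ?sqr_ge0.
apply: (@le_trans _ _ (Cg * enorm z ^+ 2 * expR (- (lambda * T)))).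
  by rewrite ler_wpM2r.
by rewrite ler_piMr.
Qed.

Local Notation lip := (dcost_lip T Lf LL Lg).
Local Notation semi := (dcost_semi T Lf LL Lg CL Cg Cf).
Local Notation dJ := (dcost h grid_dynamics grid_cost final_cost).
Local Notation dV := (dvalue U h grid_dynamics grid_cost final_cost).

Let NhT : N%:R * h <= T. Proof. by rewrite mul_Dt. Qed.

Let FL k v x y : (0 < k < N)%N -> v \in U ->
  enorm (grid_dynamics k x v - grid_dynamics k y v) <= Lf * enorm (x - y).
Proof. by move=> kN vU; apply: fL => //; exact: grid_time. Qed.

Let FM k v x : (0 < k < N)%N -> v \in U -> enorm (grid_dynamics k x v) <= Mf.
Proof. by move=> kN vU; apply: fM => //; exact: grid_time. Qed.

Let FC k v (x z : V) : (0 < k < N)%N -> v \in U ->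
  enorm (grid_dynamics k (x + z) v - 2 *: grid_dynamics k x v
         + grid_dynamics k (x - z) v) <= Cf * enorm z ^+ 2.
Proof.
by move=> kN vU; apply: dynamics_second_difference => //; exact: grid_time_interior.
Qed.

Let J_bounded j k x u := @dcost_bounded R d 'rV[R]_m U N h T grid_dynamics grid_cost
  final_cost ML Mg Dt_gt0 NhT ML0 final_cost_bounded grid_cost_bounded j k x u.
Let J_lip j k x y u := @dcost_lipschitz R d 'rV[R]_m U N h T grid_dynamics grid_cost
  final_cost Lf LL Lg Dt_gt0 NhT Lf0 LL0 Lg0 final_cost_lipschitz
  grid_cost_lipschitz FL j k x y u.
Let J_shadow j k z u rho := @dcost_shadow R d 'rV[R]_m U N h T grid_dynamics grid_cost
  final_cost Lf LL Lg Dt_gt0 Dt_le NhT Lf0 LL0 Lg0 final_cost_lipschitz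
  grid_cost_lipschitz FL j k z u rho.
Let V_lip j k x y := @dvalue_lipschitz R d 'rV[R]_m U N h T grid_dynamics grid_cost
  final_cost ML Mg Lf LL Lg Dt_gt0 NhT U0 ML0 Lf0 LL0 Lg0 final_cost_bounded
  final_cost_lipschitz grid_cost_bounded grid_cost_lipschitz FL j k x y.
Let V_path j k z w rho := @dvalue_relaxed_path R d 'rV[R]_m U N h T grid_dynamics
  grid_cost final_cost Mf ML Mg Lf LL Lg CL Cg Cf Dt_gt0 Dt_le NhT U0 ML0 Lf0 LL0 Lg0
  CL0 Cg0 Cf0 final_cost_bounded final_cost_lipschitz final_cost_semiconcave
  grid_cost_bounded grid_cost_lipschitz grid_cost_semiconcave FM FL FC j k z w rho.

Lemma grid_indexP s : 0 <= s < T ->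
  [/\ (grid_index T N s < N)%N, (grid_index T N s)%:R * h <= s &
      s < (grid_index T N s).+1%:R * h].
Proof.
move=> /andP[s0 sT]; have q0 : 0 <= s / h by rewrite divr_ge0 ?(ltW Dt_gt0).
have /andP[h1 h2] := truncn_itv q0; split.
- by rewrite /grid_index truncn_lt_nat// ltr_pdivrMr ?Dt_gt0// mul_Dt.
- by rewrite -ler_pdivlMr ?Dt_gt0.
- by rewrite -ltr_pdivrMr ?Dt_gt0.
Qed.

Lemma steps_sqr_le j : (j <= N)%N -> j%:R * h ^+ 2 <= T * h.
Proof.
by move=> jN; rewrite expr2 mulrA ler_wpM2r ?(ltW Dt_gt0)// grid_le_horizon.
Qed.

(** * Comparison from a fixed initial time [s], with [k] the first grid index after it *)

Section InitialTime.
Context (x : V) (s : R) (sT : 0 <= s < T).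
Local Notation k := (grid_index T N s).+1.
Local Notation j := (N - k)%N.

Lemma levels_left : (k + j = N)%N.
Proof. by have [sN _ _] := grid_indexP sT; rewrite subnKC. Qed.

Let s0 : 0 <= s. Proof. by case/andP: sT. Qed.
Let sk : s <= k%:R * h. Proof. by have [_ _ /ltW] := grid_indexP sT. Qed.
Let skh : k%:R * h - s <= h.
Proof. by have [_ h1 _] := grid_indexP sT; have := gridS (grid_index T N s); lra. Qed.
Let kN : (k + j <= N)%N. Proof. by rewrite levels_left. Qed.

(** The integral over the partial cell from s to t_k is not approximated but estimated by ML * h;
    from t_k on the grid quadrature applies. *)
Lemma cost_quadrature u y : control T U s u -> solution T f x s u y ->
  `|expR (- (lambda * s)) * cost T lambda L g s u y
    - (\sum_(k <= i < k + j) \sum_(v <- U)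
        occupation u (i%:R * h) (i.+1%:R * h) v * grid_cost i (y (i%:R * h)) v
       + final_cost (y ((k + j)%:R * h)))|
  <= (ML + quadrature_const) * h.
Proof.
move=> cu sy.
have kT : k%:R * h <= T by have [sN _ _] := grid_indexP sT; exact: grid_le_horizon.
have [int _] := running_cost_integrable s0 cu sy (lexx s) (le_trans sk kT) (lexx T).
have -> : expR (- (lambda * s)) * cost T lambda L g s u y =
    \int[mu]_(r in `[s, T]) (L (y r) (u r) r * expR (- (lambda * r)))
    + final_cost (y T).
  have split_disc r : expR (- lambda * (r - s)) =
      expR (lambda * s) * expR (- (lambda * r)).
    by rewrite -expRD; congr expR; ring.
  rewrite /cost mulrDr; congr (_ + _); last first.
    rewrite split_disc /final_cost mulrCA [X in _ * X]mulrA -expRD addNr expR0.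
    by rewrite mul1r.
  under eq_Rintegral do rewrite split_disc mulrCA.
  by rewrite RintegralZl// mulrA -expRD addNr expR0 mul1r.
rewrite levels_left mul_Dt (Rintegral_itv_split sk kT int).
have [int1 bnd1] := running_cost_integrable s0 cu sy (lexx s) sk kT.
have mL : measurable_fun `[s, k%:R * h] (fun r => L (y r) (u r) r * expR (- (lambda * r))).
  by apply/measurable_EFinP; exact: measurable_int int1.
have := Rintegral_itv_bound sk mL bnd1.
have : ML * (k%:R * h - s) <= ML * h by rewrite ler_wpM2l.
have := running_cost_quadrature s0 cu sy sk kN.
rewrite levels_left mul_Dt.
move: (\int[_]_(_ in _) _) (\int[_]_(_ in _) _) => I1 I2.
move: (\sum_(_ <= _ < _) _) (final_cost _) => S F.
rewrite !ler_norml => /andP[e1 e2] e3 /andP[e4 e5].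
by apply/andP; split; lra.
Qed.

Let lip0 : 0 <= lip.
Proof. exact: (@dcost_lip_ge0 R h T Lf LL Lg Dt_gt0 Dt_le LL0 Lg0). Qed.

Lemma initial_step_solution u y : control T U s u -> solution T f x s u y ->
  enorm (x - y (k%:R * h)) <= d%:R * Mf * h.
Proof.
move=> cu sy.
have kT : k%:R * h <= T by have [sN _ _] := grid_indexP sT; exact: grid_le_horizon.
have -> : x = y s.
  apply/rowP => i; rewrite (sy.2 s) ?lexx ?(ltW (andP sT).2)//.
  by rewrite set_itv1 Rintegral_set1 addr0.
rewrite enormC -mulrA; apply: le_trans (solution_lipschitz s0 cu sy (lexx s) sk kT) _.
by rewrite ler_wpM2l// ler_wpM2l.
Qed.

Lemma grid_step_solution u y i : control T U s u -> solution T f x s u y ->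
  (k <= i < k + j)%N ->
  enorm (y (i.+1%:R * h) - (y (i%:R * h)
    + \sum_(v <- U) occupation u (i%:R * h) (i.+1%:R * h) v
        *: grid_dynamics i (y (i%:R * h)) v))
  <= d%:R * (Kf * ((d%:R * Mf + 1) * h) * h).
Proof.
move=> cu sy /andP[ki ij].
have iT : i.+1%:R * h <= T by rewrite grid_le_horizon// (leq_trans ij kN).
have := solution_step s0 cu sy (le_trans sk (grid_le ki)) (grid_le (leqnSn i)) iT.
by rewrite gridS.
Qed.

(** In order: the running cost of the partial cell, the quadrature, the displacement from x to
    y(t_k), and the local and Jensen errors of at most T / h steps. *)
Definition lower_const : R :=
  ML + quadrature_const + lip * (d%:R * Mf)
  + T * (lip * (d%:R * (Kf * (d%:R * Mf + 1))) + semi / 2 * Mf ^+ 2).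

Lemma dvalue_le_cost u y : control T U s u -> solution T f x s u y ->
  dV j k x <= expR (- (lambda * s)) * cost T lambda L g s u y + lower_const * h.
Proof.
move=> cu sy.
have tk i : (k <= i)%N -> s <= i%:R * h by move=> ki; exact: le_trans sk (grid_le ki).
have iT i : (i < k + j)%N -> i.+1%:R * h <= T.
  by move=> ij; rewrite grid_le_horizon// (leq_trans ij kN).
have kT : k%:R * h <= T by have [sN _ _] := grid_indexP sT; exact: grid_le_horizon.
pose w i v := occupation u (i%:R * h) (i.+1%:R * h) v.
have mu_u i v : (k <= i < k + j)%N ->
    measurable (`[i%:R * h, i.+1%:R * h] `&` u @^-1` [set v] : set R).
  by move=> /andP[ki ij]; exact: control_preimage cu (tk _ ki) (iT _ ij).
have w0 i v : (k <= i < k + j)%N -> v \in U -> 0 <= w i v.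
  by move=> ki _; exact: occupation_ge0.
have wh i : (k <= i < k + j)%N -> \sum_(v <- U) w i v = h.
  move=> kij; have /andP[ki ij] := kij.
  rewrite -[RHS](gridS i); apply: sum_occupation => //; first exact: grid_le.
  - by move=> v; exact: mu_u.
  - move=> r /andP[ar rb]; apply: cu.2.
    by rewrite (le_trans (tk _ ki) ar) (le_trans rb (iT _ ij)).
have f3 := V_path (z := fun i => y (i%:R * h)) (isT : (0 < k)%N) kN w0 wh
  (fun i => grid_step_solution cu sy).
have f1 := V_lip x (y (k%:R * h)) (isT : (0 < k)%N) kN.
have f4 := cost_quadrature cu sy.
have yk := initial_step_solution cu sy.
have f2 : lip * enorm (x - y (k%:R * h)) <= lip * (d%:R * Mf * h).
  by rewrite ler_wpM2l.
have semi0 : 0 <= semi.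
  exact: (@dcost_semi_ge0 R h T Lf LL Lg CL Cg Cf Dt_gt0 Dt_le LL0 Lg0 CL0 Cg0 Cf0).
set c := lip * (d%:R * (Kf * (d%:R * Mf + 1))) + semi / 2 * Mf ^+ 2.
have c0 : 0 <= c.
  have e1 : 0 <= d%:R * Mf + 1 by rewrite addr_ge0// mulr_ge0.
  have e2 : 0 <= lip * (d%:R * (Kf * (d%:R * Mf + 1))).
    by do 3 apply: mulr_ge0 => //.
  have e3 : 0 <= semi / 2 * Mf ^+ 2 by rewrite mulr_ge0 ?sqr_ge0// divr_ge0.
  exact: addr_ge0.
have f5 := ler_wpM2r c0 (steps_sqr_le (leq_subr k N)).
have cE : j%:R * (lip * (d%:R * (Kf * ((d%:R * Mf + 1) * h) * h))
    + semi / 2 * (h ^+ 2 * Mf ^+ 2)) = j%:R * h ^+ 2 * c by rewrite /c; ring.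
rewrite cE in f3; rewrite ler_norml in f4; case/andP: f4 => f4 _.
rewrite /lower_const -/c.
rewrite (_ : _ * h = (ML + quadrature_const) * h + lip * (d%:R * Mf * h) + T * h * c).
  have chain (Vx Vy S E l1 l2 c1 c2 Q : R) : Vx <= Vy + l1 -> l1 <= l2 ->
      Vy <= S + c1 -> - Q <= E - S -> c1 <= c2 -> Vx <= E + (Q + l2 + c2).
    by lra.
  exact: chain f1 f2 f3 f4 f5.
by ring.
Qed.

(** The index is capped at N - 1: at r = T it would be N, where nothing is known of [c]. *)
Definition step_control (c : nat -> 'rV[R]_m) (r : R) : 'rV[R]_m :=
  c (minn (Num.truncn (r / h)) N.-1).

Lemma step_controlE c i r : (i < N)%N -> i%:R * h <= r < i.+1%:R * h ->
  step_control c r = c i.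
Proof.
move=> iN /andP[ir ri]; rewrite /step_control (@truncn_def _ _ i).
  by rewrite (minn_idPl _)// -ltnS prednK.
by rewrite ler_pdivlMr ?ltr_pdivrMr ?Dt_gt0// ir ri.
Qed.

Lemma step_control_admissible c :
  (forall i, (grid_index T N s <= i < N)%N -> c i \in U) ->
  control T U s (step_control c).
Proof.
have [nN _ _] := grid_indexP sT.
have idx_lt r : (minn (Num.truncn (r / h)) N.-1 < N)%N.
  by rewrite -[ltnRHS]prednK// ltnS geq_minr.
move=> cU; split; last first.
  move=> r /andP[sr rT]; apply: cU; rewrite idx_lt andbT leq_min.
  rewrite -[X in _ && X]ltnS (prednK N0) nN andbT; apply: le_truncn.
  by rewrite ler_pM2r// invr_gt0 Dt_gt0.
move=> _ Y mY.
have -> : `[s, T] `&` step_control c @^-1` Y =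
    \bigcup_(i in [set i | (i < N)%N /\ Y (c i)])
      (`[s, T] `&` [set r | minn (Num.truncn (r / h)) N.-1 = i]).
  apply/seteqP; split=> r /=.
    move=> [rsT Yr]; exists (minn (Num.truncn (r / h)) N.-1) => //.
  by move=> [i /= [iN Yi] [rsT ri]]; split=> //; rewrite /step_control ri.
apply: bigcup_measurable => i [iN _].
have r0 r : `[s, T]%classic r -> 0 <= r / h.
  rewrite /= in_itv/= => /andP[sr _].
  by rewrite divr_ge0 ?(ltW Dt_gt0)// (le_trans s0 sr).
(* Because of the cap, the last index is taken on a half-line instead of a cell. *)
have [iN1|iN1] := ltnP i N.-1.
  have -> : `[s, T] `&` [set r | minn (Num.truncn (r / h)) N.-1 = i] =
      `[s, T] `&` `[i%:R * h, i.+1%:R * h[.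
    apply/seteqP; split=> r /= [rsT]; rewrite in_itv/=.
      rewrite /minn; case: ifP => _ ri; last by rewrite ri ltnn in iN1.
      split=> //; have := truncn_itv (r0 _ rsT).
      by rewrite ri ler_pdivlMr ?ltr_pdivrMr ?Dt_gt0.
    move=> /andP[h1 h2]; split=> //; rewrite (@truncn_def _ _ i).
      by rewrite (minn_idPl _)// ltnW.
    by rewrite ler_pdivlMr ?ltr_pdivrMr ?Dt_gt0// h1 h2.
  by apply: measurableI; exact: measurable_itv.
have -> : `[s, T] `&` [set r | minn (Num.truncn (r / h)) N.-1 = i] =
    `[s, T] `&` `[i%:R * h, +oo[.
  have iE : i = N.-1 by apply/eqP; rewrite eqn_leq iN1 -ltnS prednK// iN.
  apply/seteqP; split=> r /= [rsT H]; split=> //.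
    rewrite in_itv/= andbT -ler_pdivlMr ?Dt_gt0// -truncn_ge_nat ?r0//.
    by rewrite -H geq_minl.
  move: H; rewrite in_itv/= andbT iE => H.
  by apply/minn_idPr; rewrite truncn_ge_nat ?r0// ler_pdivlMr ?Dt_gt0.
by apply: measurableI; exact: measurable_itv.
Qed.

(** On the closed cell the control can leave [c i] only at the right endpoint, a null set. The other
    controls thus have occupation time 0, and [c i] receives the whole length through
    [sum_occupation]. *)
Lemma occupation_step_control c i v :
  (forall i, (grid_index T N s <= i < N)%N -> c i \in U) ->
  (k <= i < N)%N -> v \in U ->
  occupation (step_control c) (i%:R * h) (i.+1%:R * h) v =
    if v == c i then h else 0.
Proof.
move=> cU /andP[ki iN] vU; have cc := step_control_admissible cU.
have si : s <= i%:R * h by exact: le_trans sk (grid_le ki).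
have iT : i.+1%:R * h <= T by exact: grid_le_horizon.
have mS w : measurable (`[i%:R * h, i.+1%:R * h]
    `&` step_control c @^-1` [set w] : set R) by exact: control_preimage cc si iT.
have occ0 w : w != c i ->
    occupation (step_control c) (i%:R * h) (i.+1%:R * h) w = 0.
  move=> wc; rewrite /occupation.
  suff -> : mu (`[i%:R * h, i.+1%:R * h] `&` step_control c @^-1` [set w]) = 0%E by [].
  apply/eqP; rewrite eq_le measure_ge0 andbT.
  rewrite -(@lebesgue_measure_set1 R (i.+1%:R * h)); apply: le_measure; rewrite ?inE//.
  exact: mS.
  move=> r /= [+ cr]; rewrite in_itv/= => /andP[ir].
  rewrite le_eqVlt => /predU1P[//|ri]; exfalso; move/eqP: wc; apply.
  by rewrite -cr (step_controlE _ iN)// ir ri.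
case: eqVneq => [->|/occ0//].
have ciU : c i \in U by apply: cU; rewrite (ltnW ki).
have := @sum_occupation R _ U (step_control c) _ _ uU (grid_le (leqnSn i)) mS _.
rewrite gridS => sumE; rewrite -[RHS]sumE; last first.
  by move=> r /andP[ir ri]; apply: cc.2; rewrite (le_trans si ir) (le_trans ri iT).
by rewrite (bigD1_seq (c i))//= big1 ?addr0// => w /occ0.
Qed.

(** The module E is the state space for the dynamics and [R^o] for the running cost. *)
Lemma sum_step_control (E : lmodType R) c i (H : 'rV[R]_m -> E) :
  (forall i, (grid_index T N s <= i < N)%N -> c i \in U) -> (k <= i < N)%N ->
  \sum_(v <- U) occupation (step_control c) (i%:R * h) (i.+1%:R * h) v *: H v =
  h *: H (c i).
Proof.
move=> cU kiN; have /andP[ki iN] := kiN.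
have ciU : c i \in U by apply: cU; rewrite (ltnW ki).
rewrite (bigD1_seq (c i))//= occupation_step_control// eqxx big_seq_cond big1 ?addr0//.
move=> v /andP[vU vc]; rewrite occupation_step_control// (negbTE vc).
by rewrite scale0r.
Qed.

(** As [lower_const] without the Jensen term, since a piecewise constant control needs no
    relaxation. *)
Definition upper_const : R :=
  ML + quadrature_const + lip * (d%:R * Mf)
  + T * (lip * (d%:R * (Kf * (d%:R * Mf + 1)))).

Lemma step_control_cost c y :
  (forall i, (grid_index T N s <= i < N)%N -> c i \in U) ->
  solution T f x s (step_control c) y ->
  `|expR (- (lambda * s)) * cost T lambda L g s (step_control c) y - dJ j k x c|
  <= upper_const * h.
Proof.
move=> cU sy; have cu := step_control_admissible cU.
have f4 := cost_quadrature cu sy.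
have cU' : admissible U j k c.
  by move=> i; rewrite levels_left => /andP[ki ij]; apply: cU; rewrite (ltnW ki).
have zE i : (k <= i < k + j)%N -> enorm (y (i.+1%:R * h) - (y (i%:R * h)
      + h *: grid_dynamics i (y (i%:R * h)) (c i)))
    <= d%:R * (Kf * ((d%:R * Mf + 1) * h) * h).
  move=> kij; have := grid_step_solution cu sy kij.
  by rewrite levels_left in kij; rewrite sum_step_control.
have f3 := J_shadow (z := fun i => y (i%:R * h)) (isT : (0 < k)%N) kN cU' zE.
have f1 := J_lip x (y (k%:R * h)) (isT : (0 < k)%N) kN cU'.
have f2 : lip * enorm (x - y (k%:R * h)) <= lip * (d%:R * Mf * h).
  by rewrite ler_wpM2l// (initial_step_solution cu sy).
set e := lip * (d%:R * (Kf * (d%:R * Mf + 1))).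
have e0 : 0 <= e.
  have e1 : 0 <= d%:R * Mf + 1 by rewrite addr_ge0// mulr_ge0.
  by do 3 apply: mulr_ge0 => //.
have f5 := ler_wpM2r e0 (steps_sqr_le (leq_subr k N)).
rewrite (_ : j%:R * (lip * _) = j%:R * h ^+ 2 * e) in f3; last by rewrite /e; ring.
have sumE : \sum_(k <= i < k + j) \sum_(v <- U) occupation (step_control c)
      (i%:R * h) (i.+1%:R * h) v * grid_cost i (y (i%:R * h)) v =
    \sum_(k <= i < k + j) h * grid_cost i (y (i%:R * h)) (c i).
  apply: eq_big_nat => i; rewrite levels_left => kij.
  exact: (@sum_step_control R^o).
rewrite sumE in f4.
rewrite (_ : upper_const * h =
  (ML + quadrature_const) * h + lip * (d%:R * Mf * h) + T * h * e); last first.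
  by rewrite /upper_const -/e; ring.
have chain (E S Jy Jx l1 l2 c1 c2 Q : R) : `|E - S| <= Q -> `|S - Jy| <= c1 ->
    `|Jx - Jy| <= l1 -> l1 <= l2 -> c1 <= c2 -> `|E - Jx| <= Q + l2 + c2.
  by rewrite !ler_norml => /andP[? ?] /andP[? ?] /andP[? ?] ? ?;
    apply/andP; split; lra.
exact: chain f4 f3 f1 f2 f5.
Qed.

(** * Pruning error and comparison of the infima *)

Section PrunedTree.
Context (C eps : R)
  (order : nat -> seq ('rV[R]_d * 'rV[R]_m) -> seq ('rV[R]_d * 'rV[R]_m))
  (nearest : 'rV[R]_d -> seq 'rV[R]_d -> 'rV[R]_d).
Hypotheses (C0 : 0 <= C) (eps0 : 0 < eps) (epsC : eps <= C * h ^+ 2).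
Local Notation eta := (pruned_traj T U f N eps order nearest x s).

Lemma prune_err_le (z : V) r : enorm (prune_err nearest eps z r) <= eps.
Proof.
rewrite /prune_err; case: ifP => [/andP[_]|_]; first by rewrite enormC.
by rewrite enorm0 ltW.
Qed.

Lemma pruned_traj_step u i :
  enorm (eta u i.+1 - euler T f N s i (eta u i) (u (grid_index T N s + i)%N)) <= eps.
Proof. by rewrite /= /child /pruned addrC addKr prune_err_le. Qed.

(** In order: the running cost of the partial step, the displacement from x to the first pruned node
    (an Euler step plus a merge, with h^2 <= T h), and the merges at the later levels. *)
Definition prune_const : R :=
  ML + lip * (Mf + C * T) + T * (lip * C).

Lemma pruned_cost_approx u : discrete_control T U N s u ->
  `|expR (- (lambda * s)) * pruned_cost T lambda U f L g N eps order nearest x s u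
    - dJ j k x u| <= prune_const * h.
Proof.
move=> uU'; set n := grid_index T N s.
have [nN ns sn] := grid_indexP sT.
have h0 := Dt_gt0.
have uad : admissible U j k u.
  by move=> i; rewrite levels_left => /andP[ki ij]; apply: uU'; rewrite (ltnW ki).
pose z i := eta u (i - n)%N.
have zE i : (k <= i < k + j)%N ->
    enorm (z i.+1 - (z i + h *: grid_dynamics i (z i) (u i))) <= C * h ^+ 2.
  move=> /andP[ki _]; apply: le_trans epsC.
  rewrite /z subSn ?(ltnW ki)//.
  have := pruned_traj_step u (i - n)%N.
  rewrite subnKC ?(ltnW ki)// /euler.
  (* Since i >= n + 1, the depth i - n is positive, so the step is a full one from t_i; the partial
     step at depth 0 is treated through [zk]. *)
  have -> : tree_dt T N s (i - n) = h by rewrite -(subnSK ki).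
  have -> // : tree_time T N s (i - n) = i%:R * h.
  by rewrite -(subnSK ki) /tree_time (subnSK ki) subnKC ?(ltnW ki).
have f3 := J_shadow (isT : (0 < k)%N) kN uad zE.
have f1 := J_lip x (z k) (isT : (0 < k)%N) kN uad.
have zk : enorm (x - z k) <= (Mf + C * T) * h.
  rewrite enormC /z subSnn.
  have := pruned_traj_step u 0; rewrite addn0 /euler /=.
  set q := f x _ s; set w := child _ _ _ _ _ => wE.
  have -> : w - x = (w - (x + (grid T N n.+1 - s) *: q)) + (grid T N n.+1 - s) *: q.
    by apply/rowP => i; rewrite !mxE; ring.
  apply: le_trans (ler_enormD _ _) _; rewrite addrC mulrDl; apply: lerD.
    rewrite enormZ ger0_norm ?subr_ge0 ?(ltW sn)// mulrC.
    apply: ler_pM; rewrite ?enorm_ge0 ?subr_ge0 ?(ltW sn)//.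
    apply: fM; last by rewrite s0 ltW//; case/andP: sT.
    by apply: uU'; rewrite leqnn.
  apply: le_trans wE _; apply: le_trans epsC _.
  by rewrite -mulrA ler_wpM2l// expr2 ler_wpM2r ?(ltW h0)// Dt_le.
have f2 : lip * enorm (x - z k) <= lip * ((Mf + C * T) * h) by rewrite ler_wpM2l.
have e0 : 0 <= lip * C by rewrite mulr_ge0.
have f5 := ler_wpM2r e0 (steps_sqr_le (leq_subr k N)).
rewrite (_ : j%:R * (lip * _) = j%:R * h ^+ 2 * (lip * C)) in f3; last by ring.
pose first := expR (- (lambda * s)) * ((k%:R * h - s) * L x (u n) s).
have costE : expR (- (lambda * s)) *
      pruned_cost T lambda U f L g N eps order nearest x s u =
    first + (\sum_(k <= i < k + j) h * grid_cost i (z i) (u i)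
             + final_cost (z (k + j)%N)).
  have split_disc r : expR (- lambda * (r - s)) =
      expR (lambda * s) * expR (- (lambda * r)).
    by rewrite -expRD; congr expR; ring.
  rewrite /pruned_cost -/n mulrDr [X in X + _]mulrDr -addrA levels_left; congr (_ + (_ + _)).
    rewrite mulrCA !mulr_sumr; apply: eq_bigr => i _.
    rewrite split_disc /grid_cost -/(z i); congr (_ * _).
    by rewrite mulrCA [X in _ * X]mulrA -expRD addNr expR0 mul1r.
  rewrite split_disc /final_cost -/(z N) mulrCA [X in _ * X]mulrA -expRD addNr.
  by rewrite expR0 mul1r.
have firstE : `|first| <= ML * h.
  have /andP[d0 d1] := discount_le1 s0.
  rewrite /first normrM (ger0_norm d0) -[leRHS]mul1r; apply: ler_pM => //.
  have ks0 : 0 <= k%:R * h - s by rewrite subr_ge0 ltW.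
  rewrite normrM mulrC (ger0_norm ks0); apply: ler_pM => //.
  apply: LM; last by rewrite s0 ltW//; case/andP: sT.
  by apply: uU'; rewrite leqnn.
rewrite costE (_ : prune_const * h =
    ML * h + lip * ((Mf + C * T) * h) + T * h * (lip * C)); last first.
  by rewrite /prune_const; ring.
have chain (E S Jy Jx l1 l2 c1 c2 Q : R) : `|E| <= Q -> `|S - Jy| <= c1 ->
    `|Jx - Jy| <= l1 -> l1 <= l2 -> c1 <= c2 -> `|E + S - Jx| <= Q + l2 + c2.
  by rewrite !ler_norml => /andP[? ?] /andP[? ?] /andP[? ?] ? ?;
    apply/andP; split; lra.
exact: chain firstE f3 f1 f2 f5.
Qed.

(** A control admissible from index k says nothing about the partial cell, index k - 1, where a
    discrete control must also lie in [U]. Any element of [U] will do there, as [dcost] from k does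
    not read it. *)
Lemma extend_control u : admissible U j k u -> exists2 u',
  (forall i, (grid_index T N s <= i < N)%N -> u' i \in U) &
  dJ j k x u' = dJ j k x u.
Proof.
move=> uad; have [v vU] : exists v, v \in U.
  by case: (U : seq _) U0 => // v r _; exists v; exact: mem_head.
exists (fun i => if (i < k)%N then v else u i).
  move=> i /andP[_ iN]; case: ltnP => // ki.
  by apply: uad; rewrite ki levels_left.
by apply: eq_dcost => i ki; rewrite ltnNge ki.
Qed.

Lemma quadrature_const_ge0 : 0 <= quadrature_const.
Proof.
have := @oscillation_bound_ge0 R T ML LL CL (d%:R * Mf) (ltW T0) ML0 LL0 CL0.
move=> /(_ ltac:(by rewrite mulr_ge0)) osc0.
have T0' := ltW T0.
apply: addr_ge0; last exact: mulr_ge0.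
apply: mulr_ge0 => //; apply: addr_ge0; last exact: mulr_ge0.
by do 2 apply: mulr_ge0 => //.
Qed.

Let step_const_ge0 : 0 <= lip * (d%:R * (Kf * (d%:R * Mf + 1))).
Proof.
have e1 : 0 <= d%:R * Mf + 1 by rewrite addr_ge0// mulr_ge0.
by do 3 apply: mulr_ge0 => //.
Qed.

Let base_const_ge0 : 0 <= ML + quadrature_const + lip * (d%:R * Mf).
Proof.
apply: addr_ge0; first exact: addr_ge0 ML0 quadrature_const_ge0.
by do 2 apply: mulr_ge0 => //.
Qed.

Lemma lower_const_ge0 : 0 <= lower_const.
Proof.
apply: addr_ge0; first exact: base_const_ge0.
apply: mulr_ge0 (ltW T0) _; apply: addr_ge0; first exact: step_const_ge0.
rewrite mulr_ge0 ?sqr_ge0// divr_ge0//.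
exact: (@dcost_semi_ge0 R h T Lf LL Lg CL Cg Cf Dt_gt0 Dt_le LL0 Lg0 CL0 Cg0 Cf0).
Qed.

Lemma upper_const_ge0 : 0 <= upper_const.
Proof.
apply: addr_ge0; first exact: base_const_ge0.
exact: mulr_ge0 (ltW T0) step_const_ge0.
Qed.

Lemma prune_const_ge0 : 0 <= prune_const.
Proof.
have T0' := ltW T0.
apply: addr_ge0; first apply: addr_ge0 => //.
  by apply: mulr_ge0 => //; apply: addr_ge0 => //; apply: mulr_ge0.
by do 2 apply: mulr_ge0 => //.
Qed.

Hypothesis solvable : uniquely_solvable T U f.

Lemma value_approx_initial :
  `|value T lambda U f L g x s
    - pruned_value T lambda U f L g N eps order nearest x s|
  <= expR (lambda * T) * (lower_const + upper_const + prune_const) * h.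
Proof.
have h0 := Dt_gt0; have sT' : s < T by case/andP: sT.
have sTle : 0 <= s <= T by rewrite s0 ltW.
set E := expR (lambda * s); set e := expR (- (lambda * s)).
have e0 : 0 < e := expR_gt0 _.
have E0 : 0 < E := expR_gt0 _.
have Ee : E * e = 1 by rewrite -expRD subrr expR0.
have ET : E <= expR (lambda * T) by rewrite ler_expR ler_wpM2l// ltW.
rewrite /pruned_value lt_eqF// /value.
set S := [set c | _]; set P := [set _ | _ in _].
have S_lb c : S c -> E * (dV j k x - lower_const * h) <= c.
  move=> [u [y [cu sy ->]]]; have := dvalue_le_cost cu sy.
  by rewrite -lerBlDr -/e -(ler_pM2l E0) [E * (e * _)]mulrA Ee mul1r.
have P_near u : discrete_control T U N s u ->
    E * (dJ j k x u - prune_const * h) <=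
      pruned_cost T lambda U f L g N eps order nearest x s u <=
    E * (dJ j k x u + prune_const * h).
  move=> /pruned_cost_approx; rewrite ler_distl -/e.
  by rewrite -(ler_pM2l E0) -[X in _ && X](ler_pM2l E0) ![E * (e * _)]mulrA Ee !mul1r.
have step_near u : discrete_control T U N s u ->
    exists2 c, S c & c <= E * (dJ j k x u + upper_const * h).
  move=> uU'; have cc := step_control_admissible uU'.
  have [y sy _] := solvable x sTle cc.
  exists (cost T lambda L g s (step_control u) y); first by exists (step_control u), y.
  have := step_control_cost uU' sy; rewrite ler_distl => /andP[_].
  by rewrite -/e -(ler_pM2l E0) [E * (e * _)]mulrA Ee mul1r.
have [u0 u0ad] := admissible_ex U0 j k.
have [u1 u1U _] := extend_control u0ad.
have S0 : S !=set0 by have [c Sc _] := step_near _ u1U; exists c.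
have P0 : P !=set0 by exists (pruned_cost T lambda U f L g N eps order nearest x s u1), u1.
have Slb : has_lbound S by exists (E * (dV j k x - lower_const * h)) => c; exact: S_lb.
have Plb : has_lbound P.
  exists (E * (- dcost_max T ML Mg - prune_const * h)) => _ [u /= uU' <-].
  have /andP[+ _] := P_near u uU'; apply: le_trans; rewrite ler_pM2l// lerD2r.
  have uad : admissible U j k u.
    by move=> i; rewrite levels_left => /andP[ki ij]; apply: uU'; rewrite (ltnW ki).
  by have := J_bounded x (isT : (0 < k)%N) kN uad; rewrite ler_norml => /andP[].
(* Each discrete control is realised as an admissible control of the continuous problem, with nearly
   the same cost. *)
have SP : inf S <= inf P + E * (upper_const + prune_const) * h.
  rewrite -lerBlDr; apply: lb_le_inf => // _ [u /= uU' <-].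
  have [c Sc cu] := step_near u uU'; have := ge_inf Slb Sc.
  by have /andP[+ _] := P_near u uU'; lra.
(* Here the discrete value mediates: it is at most each continuous cost up to order h, and the
   infimum of the pruned costs is at most this value up to the pruning error. *)
have PS : inf P <= inf S + E * (lower_const + prune_const) * h.
  rewrite -lerBlDr; apply: lb_le_inf => // c /S_lb cE.
  have : e * inf P - prune_const * h <= dV j k x.
    apply: le_dvalue => // u uad; have [u' u'U <-] := extend_control uad.
    have /andP[_] := P_near u' u'U.
    have : inf P <= pruned_cost T lambda U f L g N eps order nearest x s u'.
      by apply: ge_inf => //; exists u'.
    move=> /le_trans/[apply]; rewrite -(ler_pM2l e0) [e * (E * _)]mulrA [e * E]mulrC Ee mul1r.
    by rewrite lerBlDr.
  rewrite -(ler_pM2l E0) mulrBr [E * (e * _)]mulrA Ee mul1r; lra.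
have lower0 := lower_const_ge0; have upper0 := upper_const_ge0.
have prune0 := prune_const_ge0.
have H (A : R) : 0 <= A -> E * A * h <= expR (lambda * T) * A * h.
  by move=> A0; rewrite ler_wpM2r ?(ltW h0)// ler_wpM2r.
have := H _ (addr_ge0 upper0 prune0); have := H _ (addr_ge0 lower0 prune0).
have := mulr_ge0 (mulr_ge0 (expR_ge0 (lambda * T)) lower0) (ltW h0).
have := mulr_ge0 (mulr_ge0 (expR_ge0 (lambda * T)) upper0) (ltW h0).
rewrite ler_norml => f1 f2 f3 f4; apply/andP; split; lra.
Qed.

End PrunedTree.
End InitialTime.
End Grid.

(** The time T lies outside the half-open range in which the grid index locates the initial time.
    There the interval of integration is a point and the discount is 1, so every admissible pair
    costs g x; solvability provides such a pair. *)
Lemma value_final x : uniquely_solvable T U f -> value T lambda U f L g x T = g x.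
Proof.
move=> solvable; have TT : 0 <= T <= T by rewrite (ltW T0) lexx.
have [v vU] : exists v, v \in U.
  by case: (U : seq _) U0 => // v r _; exists v; exact: mem_head.
have cv : control T U T (fun=> v).
  by split => // _; exact: measurable_cst.
have costE u y : solution T f x T u y -> cost T lambda L g T u y = g x.
  move=> sy; rewrite /cost set_itv1 Rintegral_set1 add0r subrr mulr0 expR0 mulr1.
  congr g; apply/rowP => i; rewrite (sy.2 T) ?lexx//.
  by rewrite set_itv1 Rintegral_set1 addr0.
have [y sy _] := solvable x T TT _ cv.
rewrite /value (_ : [set c | _] = [set g x]) ?inf1//.
apply/seteqP; split => c /=; first by move=> [u [z [_ /costE cE ->]]].
by move=> ->; exists (fun=> v), y; rewrite costE.
Qed.

End Comparison.

Unset Implicit Arguments.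
Set Strict Implicit.

Theorem mainTheorem4 (R : realType) (d m : nat) (hd : (1 <= d)%N) (hm : (1 <= m)%N)
  (T lambda : R) (hT : 0 < T) (hlambda : 0 <= lambda)
  (U : seq 'rV[R]_m) (hU : uniq U) (hU0 : (1 <= size U)%N)
  (f : 'rV[R]_d -> 'rV[R]_m -> R -> 'rV[R]_d)
  (L : 'rV[R]_d -> 'rV[R]_m -> R -> R) (g : 'rV[R]_d -> R)
  (hsol : uniquely_solvable T U f)
  (hf_cont : {within [set p : 'rV[R]_d * 'rV[R]_m * R | 0 <= p.2 <= T],
                continuous (fun p => f p.1.1 p.1.2 p.2)})
  (hL_cont : {within [set p : 'rV[R]_d * 'rV[R]_m * R | 0 <= p.2 <= T],
                continuous (fun p => L p.1.1 p.1.2 p.2)})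
  (hg_cont : continuous g)
  (Mf ML Mg Lf LL Lg CL Cg Kf Cf : R)
  (hMf : forall x u s, u \in U -> 0 <= s <= T -> enorm (f x u s) <= Mf)
  (hML : forall x u s, u \in U -> 0 <= s <= T -> `|L x u s| <= ML)
  (hMg : forall x, `|g x| <= Mg)
  (hLf : forall x y u s, u \in U -> 0 <= s <= T ->
     enorm (f x u s - f y u s) <= Lf * enorm (x - y))
  (hLL : forall x y u s, u \in U -> 0 <= s <= T ->
     `|L x u s - L y u s| <= LL * enorm (x - y))
  (hLg : forall x y, `|g x - g y| <= Lg * enorm (x - y))
  (hCL : forall x z u t tau, u \in U -> 0 <= t <= T -> 0 < tau ->
     0 <= t - tau <= T -> 0 <= t + tau <= T ->
     L (x + z) u (t + tau) - 2 * L x u t + L (x - z) u (t - tau)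
       <= CL * (enorm z ^+ 2 + tau ^+ 2))
  (hCg : forall x z, g (x + z) - 2 * g x + g (x - z) <= Cg * enorm z ^+ 2)
  (hKf : forall x y u s t, u \in U -> 0 <= s <= T -> 0 <= t <= T ->
     enorm (f x u s - f y u t) <= Kf * (enorm (x - y) + `|s - t|))
  (hCf : forall x z u t tau, u \in U -> 0 <= t <= T -> 0 < tau ->
     0 <= t - tau <= T -> 0 <= t + tau <= T ->
     enorm (f (x + z) u (t + tau) - 2 *: f x u t + f (x - z) u (t - tau))
       <= Cf * (enorm z ^+ 2 + tau ^+ 2))
  (C : R) :
  exists Cstar Chat : R,
  forall (N : nat) (eps : R)
    (order : nat -> seq ('rV[R]_d * 'rV[R]_m) -> seq ('rV[R]_d * 'rV[R]_m))
    (nearest : 'rV[R]_d -> seq 'rV[R]_d -> 'rV[R]_d),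
    (1 <= N)%N -> 0 < eps -> eps <= C * Dt T N ^+ 2 ->
    visit_order order -> argmin_rule nearest ->
  forall (x : 'rV[R]_d) (t : R), 0 <= t <= T ->
    `|value T lambda U f L g x t
      - pruned_value T lambda U f L g N eps order nearest x t|
    <= (Cstar + Chat) * Dt T N.
Proof.
(* The given constants carry no sign; absolute values make them nonnegative and preserve the
   bounds. *)
have norm_bound (X K A : R) : 0 <= A -> X <= K * A -> X <= `|K| * A.
  by move=> A0 /le_trans; apply; rewrite ler_wpM2r// ler_norm.
have sq_sum0 (z : 'rV[R]_d) (tau : R) : 0 <= enorm z ^+ 2 + tau ^+ 2.
  by rewrite addr_ge0// sqr_ge0.
pose lower := lower_const d T lambda U `|Mf| `|ML| `|Lf| `|LL| `|Lg| `|CL| `|Cg|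
  `|Kf| `|Cf|.
pose upper := upper_const d T lambda U `|Mf| `|ML| `|Lf| `|LL| `|Lg| `|CL| `|Kf|.
pose prune := prune_const T `|Mf| `|ML| `|Lf| `|LL| `|Lg| `|C|.
(* The first constant collects the discretisation error in both directions, the second the pruning
   error. The factor exp(lambda T) bounds exp(lambda s), which undoes the discounting to time 0. *)
exists (expR (lambda * T) * (lower + upper)), (expR (lambda * T) * prune).
move=> N eps order nearest N0 eps0 epsC _ _ x t tT; rewrite -mulrDr.
have main s : 0 <= s < T ->
    `|value T lambda U f L g x s
      - pruned_value T lambda U f L g N eps order nearest x s|
    <= expR (lambda * T) * (lower + upper + prune) * Dt T N; last first.
  case/andP: tT => t0; rewrite le_eqVlt => /predU1P[->|tT]; last by rewrite main// t0.
  rewrite (value_final lambda L g hT hU0 x hsol) /pruned_value eqxx subrr normr0.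
  (* At t = T the difference is 0; that the bound is nonnegative is read off from the case s = 0. *)
  by apply: le_trans (main 0 _); rewrite ?normr_ge0// lexx.
move=> sT; apply: (@value_approx_initial R d m T lambda U f L g `|Mf| `|ML| `|Mg| `|Lf| `|LL|
  `|Lg| `|CL| `|Cg| `|Kf| `|Cf|) => //.
- by move=> y u r uU rT; apply: le_trans (hMf y u r uU rT) (ler_norm _).
- by move=> y u r uU rT; apply: le_trans (hML y u r uU rT) (ler_norm _).
- by move=> y; apply: le_trans (hMg y) (ler_norm _).
- by move=> y z u r uU rT; apply: norm_bound (hLf y z u r uU rT); exact: enorm_ge0.
- by move=> y z u r uU rT; apply: norm_bound (hLL y z u r uU rT); exact: enorm_ge0.
- by move=> y z; apply: norm_bound (hLg y z); exact: enorm_ge0.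
- by move=> y z u r tau uU rT tau0 h1 h2; apply: norm_bound; [|exact: hCL].
- by move=> y z; apply: norm_bound; [exact: sqr_ge0|exact: hCg].
- move=> y z u r r' uU rT rT'; apply: norm_bound; [|exact: hKf].
  by rewrite addr_ge0 ?enorm_ge0.
- by move=> y z u r tau uU rT tau0 h1 h2; apply: norm_bound; [|exact: hCf].
- by apply: norm_bound => //; exact: sqr_ge0.
Qed.
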